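(* Let $S\subset\mathbb{R}$ be a finite set, ordered by the usual order, with maximal element $+$ and minimal element $-$, and let $\pmb{+}$ (resp. $\pmb{-}$) denote the configuration equal to $+$ (resp. $-$) at every site. Let $P$ be an attractive, translation invariant, non degenerate, local PCA dynamics on $S^{\mathbb{Z}^d}$. For $L\in\mathbb{N}^*$ let $\nu_{\mathcal{B}(L)}^{\pmb{+}}$ (resp. $\nu_{\mathcal{B}(L)}^{\pmb{-}}$) be the stationary measure of the finite volume dynamics $P_{\mathcal{B}(L)}^{\pmb{+}}$ (resp. $P_{\mathcal{B}(L)}^{\pmb{-}}$). Then the following two conditions are equivalent: (i) there exist $C>0$, $M>0$ and $L_1\in\mathbb{N}^*$ such that for all integers $L\ge L_1$, $$\int \sigma_0\, d\nu_{\mathcal{B}(L)}^{\pmb{+}}-\int \sigma_0\, d\nu_{\mathcal{B}(L)}^{\pmb{-}}\le C e^{-ML};$$ (ii) $P$ has a unique stationary probability measure $\nu$, and there exist $\lambda>0$ and $n_1$ such that for all $n\ge n_1$ and all local functions $f:S^{\mathbb{Z}^d}\to\mathbb{R}$, $$\sup_{\sigma\in S^{\mathbb{Z}^d}}\big|\delta_\sigma P^{(n)}(f)-\nu(f)\big|\le 2\,|||f|||\,e^{-\lambda n}.$$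
   Context: A PCA (probabilistic cellular automaton) dynamics on $S^{\mathbb{Z}^d}$ is a discrete-time Markov chain with transition kernel $P(d\sigma|\eta)=\bigotimes_{k\in\mathbb{Z}^d}p_k(d\sigma_k|\eta)$, where for each site $k$ and each $\eta\in S^{\mathbb{Z}^d}$, $p_k(\cdot|\eta)$ is a probability measure on $S$. Write $P(f)(\eta)=\int f(\sigma)P(d\sigma|\eta)$, $\nu P(d\sigma)=\int P(d\sigma|\eta)\nu(d\eta)$, $\nu P^{(n)}=(\nu P^{(n-1)})P$, and $\nu(f)=\int f\,d\nu$. A probability measure $\nu$ is stationary if $\nu P=\nu$. Non degenerate: $p_k(s|\eta)>0$ for all $k,s,\eta$. Local: for every $k$ there is a finite set $V_k\subset\mathbb{Z}^d$ such that $p_k(\cdot|\eta)$ depends only on $\eta_{V_k}$. Translation invariant: $p_k(s|\eta)=p_0(s|\theta_{-k}\eta)$ for all $k,s,\eta$, where $(\theta_{k_0}\sigma)_k=\sigma_{k-k_0}$. Configurations are ordered by $\sigma\preceq\eta$ iff $\sigma_k\le\eta_k$ for all $k$; a real function $f$ is increasing if $\sigma\preceq\eta$ implies $f(\sigma)\le f(\eta)$. $P$ is attractive if $P(f)$ is increasing whenever $f$ is increasing (equivalently, for all $k$ and $s$, $\sigma\mapsto\sum_{s'\ge s}p_k(s'|\sigma)$ is increasing). For finite $\Lambda\subset\mathbb{Z}^d$ and a boundary condition $\tau\in S^{\mathbb{Z}^d}$, the finite volume dynamics $P_\Lambda^\tau$ is the Markov chain on $S^\Lambda$ with kernel $P_\Lambda^\tau(d\sigma_\Lambda|\eta_\Lambda)=\bigotimes_{k\in\Lambda}p_k(d\sigma_k|\eta_\Lambda\tau_{\Lambda^c})$,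 where $\eta_\Lambda\tau_{\Lambda^c}$ equals $\eta$ on $\Lambda$ and $\tau$ off $\Lambda$. By non-degeneracy it has a unique stationary probability measure. $\mathcal{B}(L)=\{k\in\mathbb{Z}^d:\|k\|_1\le L\}$ with $\|k\|_1=\sum_{i=1}^d|k_i|$. A function $f$ on $S^{\mathbb{Z}^d}$ is local if it depends only on the coordinates in some finite set. For such $f$, $\Delta_f(k)=\sup\{|f(\sigma)-f(\eta)|:\sigma_j=\eta_j\ \forall j\ne k\}$ and $|||f|||=\sum_{k\in\mathbb{Z}^d}\Delta_f(k)$. *)

(* Defs.v *)
From HB Require Import structures.
From mathcomp Require Import all_boot all_order all_algebra finmap.
From mathcomp Require Import all_classical all_reals all_analysis.
From mathcomp Require Import zify.

Set Implicit Arguments.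
Unset Strict Implicit.
Unset Printing Implicit Defensive.

Import Order.TTheory GRing.Theory Num.Theory.
Import numFieldNormedType.Exports.

Local Open Scope classical_set_scope.
Local Open Scope ring_scope.

Notation site d := 'rV[int]_d.

Section sites.
Variable d : nat.

Definition norm1 (k : site d) : nat := (\sum_(i < d) `|k ord0 i|)%N.

Definition ball1 (L : nat) : {fset site d} :=
  [fset k in [seq (\row_i ((f i : nat)%:Z - L%:Z) : site d)
             | f : {ffun 'I_d -> 'I_(2 * L).+1}] | (norm1 k <= L)%N]%fset.

Lemma in_ball1 L k : (k \in ball1 L) = (norm1 k <= L)%N.
Proof.
rewrite !inE /=; apply/andP/idP => [[] //|kL]; split => //.
have kiL i : (`|k ord0 i| <= L)%N.
  by apply: leq_trans kL; rewrite /norm1 (bigD1 i) //= leq_addr.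
have lt i : (`|(k ord0 i + L%:Z)%R|%N < (2 * L).+1)%N.
  by have := kiL i; lia.
apply/mapP; exists [ffun i => Ordinal (lt i)]; first by rewrite mem_enum.
apply/rowP => i; rewrite mxE ffunE /= gez0_abs ?addrK //.
by have := kiL i; move: (k ord0 i) => z; lia.
Qed.

Lemma origin_in_ball1 L : (0 : site d) \in ball1 L.
Proof. by rewrite in_ball1 /norm1 big1 // => i _; rewrite mxE. Qed.

Definition origin (L : nat) : ball1 L := [` origin_in_ball1 L]%fset.

End sites.

(* A nonempty finite subset of R bundled with its maximal and minimal
   elements; the bundle makes the spin type pointed, which the library
   requires of measurable types. *)
Record spinSet (R : realType) := SpinSet {
  spins :> {fset R} ;
  splus : spins ;
  sminus : spins ;
  splus_max : forall s : spins, val s <= val splus ;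
  sminus_min : forall s : spins, val sminus <= val s }.

Definition spin (R : realType) (S : spinSet R) : Type := spins S.
HB.instance Definition _ (R : realType) (S : spinSet R) := Finite.on (spin S).
HB.instance Definition _ (R : realType) (S : spinSet R) :=
  isPointed.Build (spin S) (splus S).

Section configurations.
Variables (R : realType) (d : nat) (S : spinSet R).

Definition spinval (s : spin S) : R := val (s : spins S).

Definition cylinder1 : set (set (site d -> spin S)) :=
  [set A | exists k s, A = [set sigma | sigma k = s]].

(* S^(Z^d) with the product sigma-algebra of the discrete one on S *)
Definition config : Type := g_sigma_algebraType cylinder1.
HB.instance Definition _ := Measurable.on config.

Definition all_plus : config := fun=> splus S.
Definition all_minus : config := fun=> sminus S.

Definition translate (k0 : site d) (sigma : config) : config :=
  fun k => sigma (k - k0).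

Definition config_le (sigma eta : config) : Prop :=
  forall k, spinval (sigma k) <= spinval (eta k).

Definition config_increasing (f : config -> R) : Prop :=
  forall sigma eta, config_le sigma eta -> f sigma <= f eta.

Definition is_local (f : config -> R) : Prop :=
  exists A : {fset site d}, forall sigma eta : config,
    (forall k, k \in A -> sigma k = eta k) -> f sigma = f eta.

(* In \bar R, so that neither the supremum nor the sum takes a default value. *)
Definition oscillation (f : config -> R) (k : site d) : \bar R :=
  ereal_sup [set x | exists sigma eta : config,
    (forall j, j != k -> sigma j = eta j) /\ x = `|f sigma - f eta|%:E].

Definition triple_norm (f : config -> R) : \bar R :=
  \esum_(k in [set: site d]) oscillation f k.

End configurations.

Section evolution.
Context {disp : measure_display} {T : measurableType disp} {R : realType}.

Definition kstep_fun (P : R.-pker T ~> T) (nu : probability T R) (A : set T)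
  : \bar R := (\int[nu]_eta P eta A)%E.

Section instances.
Variables (P : R.-pker T ~> T) (nu : probability T R).

Let kstep0 : kstep_fun P nu set0 = 0%E.
Proof. by apply: integral0_eq => x _; rewrite measure0. Qed.

Let kstep_ge0 A : (0 <= kstep_fun P nu A)%E.
Proof. by apply: integral_ge0 => x _; exact: measure_ge0. Qed.

Let kstep_sigma_additive : semi_sigma_additive (kstep_fun P nu).
Proof.
move=> U mU tU mUU; rewrite [X in _ --> X](_ : _ =
  (\int[nu]_x (\sum_(n <oo) P x (U n)))%E); last first.
  apply: eq_integral => V _.
  by apply/esym/cvg_lim => //; exact/measure_semi_sigma_additive.
apply/cvg_closeP; split.
  by apply: is_cvg_nneseries => n _ _; exact: integral_ge0.
rewrite closeE// integral_nneseries// => n.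
exact: measurable_kernel.
Qed.

HB.instance Definition _ := isMeasure.Build _ _ R (kstep_fun P nu)
  kstep0 kstep_ge0 kstep_sigma_additive.

Let kstep_setT : kstep_fun P nu setT = 1%E.
Proof.
rewrite /kstep_fun (eq_integral (cst 1%E)) => [|x _]; last exact: prob_kernel.
by rewrite integral_cst// mul1e; exact: probability_setT.
Qed.

HB.instance Definition _ := Measure_isProbability.Build _ _ R (kstep_fun P nu)
  kstep_setT.

End instances.

Definition kstep (P : R.-pker T ~> T) (nu : probability T R)
  : probability T R := kstep_fun P nu.

Fixpoint kiter (P : R.-pker T ~> T) (n : nat) (nu : probability T R)
  : probability T R :=
  if n is n'.+1 then kstep P (kiter P n' nu) else nu.

Definition stationary (P : R.-pker T ~> T) (nu : probability T R) : Prop :=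
  forall A, measurable A -> kstep P nu A = nu A.

End evolution.

(* [pca_prod] says that [pca_kernel eta] is the product of the laws
   [rate k eta]: the finite-dimensional cylinders are a pi-system generating
   the product sigma-algebra, so the kernel is determined by the rates. *)
Record pca (R : realType) (d : nat) (S : spinSet R) := PCA {
  rate : site d -> config d S -> spin S -> R ;
  rate_ge0 : forall k eta s, 0 <= rate k eta s ;
  rate_sum1 : forall k eta, \sum_(s : spin S) rate k eta s = 1 ;
  pca_kernel :> R.-pker (config d S) ~> (config d S) ;
  pca_prod : forall (eta s : config d S) (Lambda : {fset site d}),
    pca_kernel eta [set sigma | forall k, k \in Lambda -> sigma k = s k] =
    (\prod_(k <- Lambda) rate k eta (s k))%:E }.

Section pca_properties.
Variables (R : realType) (d : nat) (S : spinSet R) (P : pca d S).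

Definition non_degenerate : Prop := forall k eta s, 0 < rate P k eta s.

Definition local_pca : Prop :=
  forall k, exists V : {fset site d}, forall sigma eta : config d S,
    (forall j, j \in V -> sigma j = eta j) ->
    forall s, rate P k sigma s = rate P k eta s.

Definition translation_invariant : Prop :=
  forall k eta s, rate P k eta s = rate P 0 (translate (- k) eta) s.

Definition apply_kernel (f : config d S -> R) (eta : config d S) : R :=
  \int[P eta]_sigma f sigma.

(* An increasing f is bounded, since it lies between its values at the two
   extremal configurations; measurability is what makes P(f) meaningful. *)
Definition attractive : Prop :=
  forall f : config d S -> R, measurable_fun [set: config d S] f ->
    config_increasing f -> config_increasing (apply_kernel f).

Definition glue (Lambda : {fset site d}) (eta : {ffun Lambda -> spin S})
    (tau : config d S) : config d S :=
  fun k => if insub k is Some j then eta j else tau k.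

Definition fv_kernel (Lambda : {fset site d}) (tau : config d S)
    (eta sigma : {ffun Lambda -> spin S}) : R :=
  \prod_(k : Lambda) rate P (val k) (glue eta tau) (sigma k).

(* m is the probability mass function of a stationary law on S^Lambda *)
Definition fv_stationary (Lambda : {fset site d}) (tau : config d S)
    (m : {ffun Lambda -> spin S} -> R) : Prop :=
  [/\ forall sigma, 0 <= m sigma,
      \sum_sigma m sigma = 1
    & forall sigma, \sum_eta m eta * fv_kernel tau eta sigma = m sigma].

End pca_properties.

Definition mean_origin (R : realType) (d : nat) (S : spinSet R) (L : nat)
    (m : {ffun ball1 d L -> spin S} -> R) : R :=
  \sum_sigma m sigma * spinval (sigma (origin d L)).

(* Main.v *)
(* Write rho_L(n) for the difference at the origin between the box B(L) with
   boundary condition + started from + and its - analogue, both at time n.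
   Splitting the time interval at t and inserting the infinite-volume law at a
   time N >= t started from + as an intermediate measure gives
     rho_2L(t + s) <= K |B(L)| rho_L(s) rho_L(t) + rho_L(N + s),
   because stochastically ordered laws differ on a local function by no more
   than a multiple of their differences at single sites.  As N grows, the last
   term tends to the spatial mixing bound C exp(- M L), so that doubling L and t
   together makes rho decay exponentially in time.  Attractiveness sandwiches
   the dynamics from any configuration between those from - and +, which yields
   exponential ergodicity; the stationary measure is the limit law from -,
   extended from local functions by Caratheodory's theorem and compactness.
   Conversely, up to time L / r the boundary of B(L) does not influence the
   origin, r being the range. *)
Require Import Defs.
From HB Require Import structures.
From mathcomp Require Import all_boot all_order all_algebra finmap.
From mathcomp Require Import all_classical all_reals all_analysis measurable_realfun.
From mathcomp Require Import zify ring lra.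

Set Implicit Arguments.
Unset Strict Implicit.
Unset Printing Implicit Defensive.

Import Order.TTheory GRing.Theory Num.Theory.
Import numFieldNormedType.Exports.

Local Open Scope classical_set_scope.
Local Open Scope ring_scope.

Local Notation glue := Defs.glue.

Section local_functions.
Variables (R : realType) (d : nat) (S : spinSet R).
Implicit Types (f g : config d S -> R) (A B : {fset site d}) (tau : config d S).

Definition depends_on A f := forall sigma eta : config d S,
  (forall k, k \in A -> sigma k = eta k) -> f sigma = f eta.

Lemma depends_onS A B f : (forall k, k \in A -> k \in B) ->
  depends_on A f -> depends_on B f.
Proof. by move=> AB fA s e se; apply: fA => k kA; apply: se; apply: AB. Qed.

Lemma is_local2 f g : is_local f -> is_local g ->
  exists A, depends_on A f /\ depends_on A g.
Proof.
move=> [A fA] [B gB]; exists (A `|` B)%fset; split.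
  by apply: depends_onS fA => k kA; rewrite in_fsetU kA.
by apply: depends_onS gB => k kA; rewrite in_fsetU kA orbT.
Qed.

Lemma is_local_cst (c : R) : is_local (fun _ : config d S => c).
Proof. by exists fset0. Qed.

Lemma is_localD f g : is_local f -> is_local g -> is_local (fun s => f s + g s).
Proof.
move=> fl gl; have [A [fA gA]] := is_local2 fl gl.
by exists A => s e se; rewrite (fA _ _ se) (gA _ _ se).
Qed.

Lemma is_localZ (c : R) f : is_local f -> is_local (fun s => c * f s).
Proof. by move=> [A fA]; exists A => s e se; rewrite (fA _ _ se). Qed.

Lemma is_local_sum (I : Type) (r : seq I) (F : I -> config d S -> R) :
  (forall i, is_local (F i)) -> is_local (fun s => \sum_(i <- r) F i s).
Proof.
move=> Fl; elim: r => [|i r IH].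
  by exists fset0 => s e _; rewrite !big_nil.
have [A FA] := is_localD (Fl i) IH.
by exists A => s e se; rewrite !big_cons (FA s e se).
Qed.

Lemma is_local_coord k : is_local (fun s : config d S => spinval (s k)).
Proof. by exists [fset k]%fset => s e se; rewrite se ?inE. Qed.

Definition cyl A (s : {ffun A -> spin S}) : set (config d S) :=
  [set sigma | forall k : A, sigma (val k) = s k].

Lemma glue_in A (s : {ffun A -> spin S}) tau (k : A) : glue s tau (val k) = s k.
Proof. by rewrite /glue valK. Qed.

Lemma glue_out A (s : {ffun A -> spin S}) tau k : k \notin A ->
  glue s tau k = tau k.
Proof. by move=> kA; rewrite /glue insubN. Qed.

Lemma cylE A (s : {ffun A -> spin S}) tau : cyl s =
  [set sigma : config d S | forall k, k \in A -> sigma k = glue s tau k].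
Proof.
apply/seteqP; split=> sigma /= h => [k kA|k].
  by rewrite (h [` kA]%fset) -(glue_in s tau).
by rewrite h ?glue_in // fsvalP.
Qed.

Lemma measurable_coord k (s : spin S) :
  measurable [set sigma : config d S | sigma k = s].
Proof. by apply: sub_sigma_algebra; exists k, s. Qed.

Lemma measurable_cyl A (s : {ffun A -> spin S}) : measurable (cyl s).
Proof.
rewrite (_ : cyl s = \bigcap_(k in [set: A]) [set sigma | sigma (val k) = s k]).
  apply: fin_bigcap_measurable => // k _; exact: measurable_coord.
by apply/seteqP; split=> sigma /= h => [k _|k]; exact: h.
Qed.

Definition restrict A (sigma : config d S) : {ffun A -> spin S} :=
  [ffun k => sigma (val k)].

Definition cut A tau (sigma : config d S) : config d S :=
  fun k => if k \in A then sigma k else tau k.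

Lemma glue_restrict A tau sigma : glue (restrict A sigma) tau = cut A tau sigma.
Proof.
apply/funext => k; rewrite /cut; case: ifPn => kA; last by rewrite glue_out.
by have := glue_in (restrict A sigma) tau ([` kA]%fset); rewrite ffunE.
Qed.

Lemma cut_glue A tau (s : {ffun A -> spin S}) : cut A tau (glue s tau) = glue s tau.
Proof.
by apply/funext => k; rewrite /cut; case: ifPn => kA //; rewrite glue_out.
Qed.

Lemma cyl_indic A (s : {ffun A -> spin S}) sigma :
  \1_(cyl s) sigma = (restrict A sigma == s)%:R :> R.
Proof.
rewrite indicE; congr (_%:R); congr nat_of_bool.
apply/idP/eqP => [|<-].
  by rewrite inE => /= h; apply/ffunP => k; rewrite ffunE h.
by rewrite inE /= => k; rewrite ffunE.
Qed.

Lemma local_expand A f tau : depends_on A f ->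
  f = fun sigma => \sum_(s : {ffun A -> spin S}) f (glue s tau) * \1_(cyl s) sigma.
Proof.
move=> fA; apply/funext => sigma.
rewrite (bigD1 (restrict A sigma)) //= big1 ?addr0 => [|s sn].
  rewrite cyl_indic eqxx mulr1 glue_restrict; apply: fA => k kA.
  by rewrite /cut kA.
by rewrite cyl_indic eq_sym (negbTE sn) mulr0.
Qed.

Lemma local_measurable f : is_local f -> measurable_fun [set: config d S] f.
Proof.
move=> [A fA]; rewrite (local_expand (@all_plus R d S) fA).
apply: measurable_sum => s; apply: measurable_funM; first exact: measurable_cst.
by apply: measurable_indic; exact: measurable_cyl.
Qed.

Lemma local_bounded f : is_local f -> exists M : R, forall s, `|f s| <= M.
Proof.
move=> [A fA].
exists (\sum_(s : {ffun A -> spin S}) `|f (glue s (@all_plus R d S))|) => s.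
rewrite {1}(local_expand (@all_plus R d S) fA).
apply: le_trans (ler_norm_sum _ _ _) _; apply: ler_sum => e _.
by rewrite normrM cyl_indic ler_piMr //; case: (_ == _); rewrite ?normr1 ?normr0.
Qed.

Lemma local_integrable (m : {measure set (config d S) -> \bar R}) f :
  m setT = 1%E -> is_local f -> m.-integrable setT (EFin \o f).
Proof.
move=> m1 fl; have [M fM] := local_bounded fl.
apply: (measurable_bounded_integrable (mu := m)) => //.
- by rewrite m1 ltry.
- exact: local_measurable.
- exists M; split; first exact: num_real.
  by move=> N MN s _ /=; apply: le_trans (fM s) (ltW MN).
Qed.

Lemma local_integral A f tau (m : {measure set (config d S) -> \bar R}) :
  m setT = 1%E -> depends_on A f ->
  \int[m]_s f s =
  \sum_(s : {ffun A -> spin S}) f (glue s tau) * fine (m (cyl s)).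
Proof.
move=> m1 fA; rewrite {1}(local_expand tau fA).
have lc s : is_local (fun sigma => \1_(cyl (s : {ffun A -> spin S})) sigma : R).
  by exists A => u v uv; rewrite !cyl_indic (_ : restrict A u = restrict A v) //;
     apply/ffunP => k; rewrite !ffunE uv // fsvalP.
elim: (index_enum _) => [|s r IH].
  rewrite big_nil (_ : (fun _ => _) = cst 0); last first.
    by apply/funext => x; rewrite big_nil.
  by rewrite Rintegral_cst // mul0r.
rewrite big_cons -IH (_ : (fun _ => _) = (fun x =>
  f (glue s tau) * \1_(cyl s) x + \sum_(i <- r) f (glue i tau) * \1_(cyl i) x));
  last by apply/funext => x; rewrite big_cons.
rewrite RintegralD //; last 2 first.
- by apply: local_integrable => //; apply: is_localZ.
- by apply: local_integrable => //; apply: is_local_sum => i; apply: is_localZ.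
congr (_ + _); rewrite RintegralZl //; last exact: local_integrable.
congr (_ * _); rewrite /Rintegral integral_indic ?setIT //; exact: measurable_cyl.
Qed.

Lemma local_integral_linear (m : {measure set (config d S) -> \bar R}) c f g :
  m setT = 1%E -> is_local f -> is_local g ->
  \int[m]_s (c * f s + g s) = c * \int[m]_s f s + \int[m]_s g s.
Proof.
move=> m1 fl gl; rewrite RintegralD //; last 2 first.
- by apply: local_integrable => //; apply: is_localZ.
- exact: local_integrable.
by rewrite RintegralZl //; exact: local_integrable.
Qed.

Lemma local_integral_le (m : {measure set (config d S) -> \bar R}) f g :
  m setT = 1%E -> is_local f -> is_local g -> (forall s, f s <= g s) ->
  \int[m]_s f s <= \int[m]_s g s.
Proof.
move=> m1 fl gl fg; apply: le_Rintegral => //; exact: local_integrable.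
Qed.

Lemma local_integral_cst (m : {measure set (config d S) -> \bar R}) (c : R) :
  m setT = 1%E -> \int[m]_s c = c.
Proof. by move=> m1; rewrite Rintegral_cst // m1 mulr1. Qed.

Lemma local_ball f : is_local f -> exists j, depends_on (ball1 d j) f.
Proof.
move=> [A fA]; exists (\max_(k <- A) norm1 k)%N.
apply: depends_onS fA => k kA; rewrite in_ball1.
exact: leq_bigmax_seq.
Qed.

End local_functions.

Section expectations.
Variables (R : realType) (d : nat) (S : spinSet R).
Local Notation cfg := (config d S).
Implicit Types (f g : cfg -> R) (mu : (cfg -> R) -> R).

Definition coord (k : site d) : cfg -> R := fun s => spinval (s k).

Definition linear_on_local mu := forall c f g, is_local f -> is_local g ->
  mu (fun s => c * f s + g s) = c * mu f + mu g.

Definition stoch_le mu mu' := forall f, is_local f -> config_increasing f ->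
  mu f <= mu' f.

Lemma linear_on_local0 mu : linear_on_local mu -> mu (fun _ => 0) = 0.
Proof.
move=> mul; have := mul 1 _ _ (is_local_cst d S 0) (is_local_cst d S 0).
under eq_fun do rewrite mulr0 addr0.
by rewrite mul1r => /eqP; rewrite addrC -subr_eq subrr => /eqP.
Qed.

Lemma linear_on_localZ mu c f : linear_on_local mu -> is_local f ->
  mu (fun s => c * f s) = c * mu f.
Proof.
move=> mul fl; have := mul c f _ fl (is_local_cst d S 0).
by under eq_fun do rewrite addr0; rewrite linear_on_local0 // addr0.
Qed.

Lemma linear_on_localD mu f g : linear_on_local mu -> is_local f ->
  is_local g -> mu (fun s => f s + g s) = mu f + mu g.
Proof.
move=> mul fl gl; have := mul 1 f g fl gl.
by under eq_fun do rewrite mul1r; rewrite mul1r.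
Qed.

Lemma linear_on_local_sum mu (I : Type) (r : seq I) (c : I -> R)
    (F : I -> cfg -> R) : linear_on_local mu -> (forall i, is_local (F i)) ->
  mu (fun s => \sum_(i <- r) c i * F i s) = \sum_(i <- r) c i * mu (F i).
Proof.
move=> mul Fl; elim: r => [|i r IH].
  by under eq_fun do rewrite big_nil; rewrite big_nil linear_on_local0.
under eq_fun do rewrite big_cons.
rewrite big_cons mul // ?IH //.
by apply: is_local_sum => j; apply: is_localZ.
Qed.

Lemma spin_gap : exists2 K : R, 1 <= K &
  forall s t : spin S, s != t -> 1 <= K * `|spinval s - spinval t|.
Proof.
pose h (p : spin S * spin S) : R := `|spinval p.1 - spinval p.2|^-1.
have h0 p : 0 <= h p by rewrite invr_ge0.
exists (1 + \sum_p h p); first by rewrite lerDl sumr_ge0.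
move=> s t st.
have D0 : 0 < `|spinval s - spinval t|.
  rewrite normr_gt0 subr_eq0; apply: contra_neq st; exact: val_inj.
rewrite -ler_pdivrMr // div1r (bigD1 (s, t)) //= addrCA lerDl.
by rewrite addr_ge0 // sumr_ge0.
Qed.

Lemma local_telescope (A : {fset site d}) f (D : site d -> R) :
  depends_on A f ->
  (forall k (s e : cfg), (forall j, j != k -> s j = e j) ->
     `|f s - f e| <= D k) ->
  forall s e : cfg, `|f s - f e| <= \sum_(k <- A) (s k != e k)%:R * D k.
Proof.
move=> fA fD s e.
pose mix (r : seq (site d)) : cfg := fun k => if k \in r then s k else e k.
have -> : f s = f (mix A) by apply: fA => k kA; rewrite /mix kA.
elim: (A : seq _) => [|k r IH].
  by rewrite big_nil (_ : mix [::] = e) ?subrr ?normr0 //; apply/funext.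
rewrite big_cons; apply: le_trans (ler_distD (f (mix r)) _ _) _.
apply: lerD => //; case: eqVneq => [sek|_]; last first.
  rewrite mul1r; apply: fD => j jk.
  by rewrite /mix in_cons (negbTE jk).
rewrite mul0r (_ : mix (k :: r) = mix r) ?subrr ?normr0 //.
apply/funext => j; rewrite /mix in_cons; case: eqVneq => //= ->.
by rewrite sek; case: ifP.
Qed.

(* [K * \sum_k D k * coord k +- f] is increasing, which replaces the coupling
   argument. *)
Lemma stoch_le_compare (K : R) mu mu' (A : {fset site d}) f (D : site d -> R) :
  0 <= K ->
  (forall s t : spin S, s != t -> 1 <= K * `|spinval s - spinval t|) ->
  linear_on_local mu -> linear_on_local mu' -> stoch_le mu mu' ->
  depends_on A f -> (forall k, 0 <= D k) ->
  (forall k (s e : cfg), (forall j, j != k -> s j = e j) ->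
     `|f s - f e| <= D k) ->
  `|mu' f - mu f| <= K * \sum_(k <- A) D k * (mu' (coord k) - mu (coord k)).
Proof.
move=> K0 Kgap mul mul' mumu' fA D0 fD.
have fl : is_local f by exists A.
have cl k : is_local (coord k) by exact: is_local_coord.
have sl : is_local (fun s => \sum_(k <- A) D k * coord k s).
  by apply: is_local_sum => k; apply: is_localZ.
have key (c : R) : `|c| = 1 -> c * mu f - c * mu' f <=
    K * \sum_(k <- A) D k * (mu' (coord k) - mu (coord k)).
  move=> c1.
  have := mumu' (fun s => K * (\sum_(k <- A) D k * coord k s) + c * f s).
  have E m : linear_on_local m ->
      m (fun s => K * (\sum_(k <- A) D k * coord k s) + c * f s) =
      K * (\sum_(k <- A) D k * m (coord k)) + c * m f.
    move=> ml; rewrite ml ?linear_on_local_sum ?linear_on_localZ //.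
    exact: is_localZ.
  rewrite !E //.
  move=> /(_ _)/wrap[|]; first by apply: is_localD; apply: is_localZ.
  move=> /(_ _)/wrap[s e se|].
    rewrite -subr_ge0 opprD addrACA -!mulrBr -sumrB.
    have /ler_normlP[h _] : `|c * (f e - f s)| <=
        \sum_(k <- A) (e k != s k)%:R * D k.
      by rewrite normrM c1 mul1r; apply: local_telescope.
    have : \sum_(k <- A) (e k != s k)%:R * D k <=
           K * (\sum_(k <- A) (D k * coord k e - D k * coord k s)).
      rewrite mulr_sumr; apply: ler_sum => k _.
      rewrite -mulrBr mulrCA mulrC ler_wpM2l //.
      have := se k; rewrite /coord; case: eqVneq => [->|ek] sek /=.
        by rewrite subrr mulr0.
      by apply: le_trans (Kgap _ _ ek) _; rewrite ger0_norm // subr_ge0.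
    by move: h; lra.
  have -> : \sum_(k <- A) D k * (mu' (coord k) - mu (coord k)) =
      \sum_(k <- A) D k * mu' (coord k) - \sum_(k <- A) D k * mu (coord k).
    by rewrite -sumrB; apply: eq_bigr => k _; rewrite mulrBr.
  by rewrite mulrBr; lra.
rewrite ler_norml; apply/andP; split.
  by rewrite lerNl opprB; have := key 1; rewrite normr1 !mul1r => ->.
have := key (-1); rewrite normrN1 !mulN1r opprK addrC => ->//.
Qed.

End expectations.

Section local_operators.
Variables (R : realType) (d : nat) (S : spinSet R).
Local Notation cfg := (config d S).
Implicit Types (f g : cfg -> R) (U V W : (cfg -> R) -> cfg -> R).

Record local_markov U : Prop := LocalMarkov {
  markov_local : forall f, is_local f -> is_local (U f) ;
  markov_linear : forall s, linear_on_local (U ^~ s) ;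
  markov_le : forall f g, is_local f -> is_local g -> (forall s, f s <= g s) ->
    forall s, U f s <= U g s ;
  markov_cst : forall c s, U (fun=> c) s = c ;
  markov_increasing : forall f, is_local f -> config_increasing f ->
    config_increasing (U f) }.

Definition op_le U V := forall f, is_local f -> config_increasing f ->
  forall s, U f s <= V f s.

Lemma iter_markov U n : local_markov U -> local_markov (iter n U).
Proof.
move=> hU; elim: n => [|n IH]; first by split.
have loc := markov_local IH.
split=> [f fl|s c f g fl gl|f g fl gl fg s|c s|f fl fi] /=.
- exact: (markov_local hU (loc _ fl)).
- rewrite -(markov_linear hU _ _ (loc _ fl) (loc _ gl)); congr (U _ _).
  by apply/funext => t; apply: (markov_linear IH).
- by apply: (markov_le hU) => [||t]; [exact: loc|exact: loc|apply: (markov_le IH)].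
- rewrite (_ : iter n U _ = fun=> c) ?(markov_cst hU) //.
  by apply/funext => t; apply: (markov_cst IH).
- by apply: (markov_increasing hU); [exact: loc|apply: (markov_increasing IH)].
Qed.

Lemma op_le_iter U V n : local_markov U -> local_markov V -> op_le U V ->
  op_le (iter n U) (iter n V).
Proof.
move=> hU hV UV f fl fi; elim: n => [|n IH] s //=.
have hUn := iter_markov n hU; have hVn := iter_markov n hV.
apply: le_trans (markov_le hU (markov_local hUn fl) (markov_local hVn fl) IH s) _.
by apply: UV; [exact: (markov_local hVn)|exact: (markov_increasing hVn)].
Qed.

Lemma all_minus_le (s : cfg) : config_le (@all_minus R d S) s.
Proof. by move=> k; apply: sminus_min. Qed.

Lemma all_plus_ge (s : cfg) : config_le s (@all_plus R d S).
Proof. by move=> k; apply: splus_max. Qed.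

Lemma iter_plus_nonincreasing U m n f : local_markov U -> (m <= n)%N ->
  is_local f -> config_increasing f ->
  iter n U f (@all_plus R d S) <= iter m U f (@all_plus R d S).
Proof.
move=> hU mn fl fi; rewrite -(subnK mn) iterD.
have hm := iter_markov m hU.
rewrite -[leRHS](markov_cst (iter_markov (n - m) hU) _ (@all_plus R d S)).
apply: (markov_le (iter_markov _ hU)) => [||s]; first exact: markov_local.
  exact: is_local_cst.
by apply: (markov_increasing hm) => //; exact: all_plus_ge.
Qed.

Lemma iter_minus_nondecreasing U m n f : local_markov U -> (m <= n)%N ->
  is_local f -> config_increasing f ->
  iter m U f (@all_minus R d S) <= iter n U f (@all_minus R d S).
Proof.
move=> hU mn fl fi; rewrite -(subnK mn) iterD.
have hm := iter_markov m hU.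
rewrite -[leLHS](markov_cst (iter_markov (n - m) hU) _ (@all_minus R d S)).
apply: (markov_le (iter_markov _ hU)) => [||s]; last first.
- by apply: (markov_increasing hm) => //; exact: all_minus_le.
- exact: markov_local.
exact: is_local_cst.
Qed.

Lemma cut_le A (tau s e : cfg) : config_le s e ->
  config_le (cut A tau s) (cut A tau e).
Proof. by move=> se k; rewrite /cut; case: ifP. Qed.

Lemma is_local_cut A (tau : cfg) f : is_local f ->
  is_local (fun s => f (cut A tau s)).
Proof.
move=> [B fB]; exists B => s e se; apply: fB => k kB.
by rewrite /cut se.
Qed.

Lemma is_local_translate k0 f : is_local f ->
  is_local (fun s : cfg => f (translate k0 s)).
Proof.
move=> [B fB]; exists [fset (k - k0) | k in B]%fset => s e se; apply: fB => k kB.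
by rewrite /translate se //; apply/imfsetP; exists k.
Qed.

Lemma coord_increasing k : config_increasing (@coord R d S k).
Proof. by move=> s e; apply. Qed.

End local_operators.

Section pca_operator.
Variables (R : realType) (d : nat) (S : spinSet R) (P : pca d S).
Local Notation cfg := (config d S).
Local Notation T := (apply_kernel P).
Implicit Types (f g : cfg -> R) (tau : cfg).

Lemma pca_cyl eta (A : {fset site d}) (s : {ffun A -> spin S}) :
  fine (P eta (cyl s)) = \prod_(k : A) rate P (val k) eta (s k).
Proof.
rewrite (cylE s (@all_plus R d S)) pca_prod /= big_seq_fsetE /=.
by apply: eq_bigr => k _; rewrite glue_in.
Qed.

Lemma apply_kernelE (A : {fset site d}) f tau eta : depends_on A f ->
  T f eta = \sum_(s : {ffun A -> spin S})
    f (glue s tau) * \prod_(k : A) rate P (val k) eta (s k).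
Proof.
move=> fA; rewrite /apply_kernel (local_integral tau (prob_kernel eta) fA).
by apply: eq_bigr => s _; rewrite pca_cyl.
Qed.

Lemma apply_kernel_indic (B : set cfg) eta : measurable B ->
  T \1_B eta = fine (P eta B).
Proof.
by move=> mB; rewrite /apply_kernel /Rintegral integral_indic ?setIT.
Qed.

Lemma apply_kernel_linear eta : linear_on_local (fun f => T f eta).
Proof. by move=> c f g fl gl; apply: local_integral_linear => //; exact: prob_kernel. Qed.

Hypothesis Ptr : translation_invariant P.

Lemma rate_translate k k0 eta s :
  rate P k (translate k0 eta) s = rate P (k - k0) eta s.
Proof.
rewrite Ptr [RHS]Ptr; congr (rate _ _ _ _).
by apply/funext => j; rewrite /translate; congr (eta _); rewrite !opprK addrA.
Qed.

Lemma apply_kernel_translate k0 f eta : is_local f ->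
  T (fun s => f (translate k0 s)) eta = T f (translate k0 eta).
Proof.
move=> [A fA]; pose tau := @all_plus R d S.
rewrite (apply_kernelE tau _ fA) {1}(local_expand tau fA).
have mB (l : {fset site d}) (t : cfg) :
    measurable [set sigma : cfg | forall k, k \in l -> sigma k = t k].
  rewrite (_ : [set _ | _] = cyl (restrict l t)).
    exact: measurable_cyl.
  apply/seteqP; split=> sigma /= h => [k|k kl]; first by rewrite ffunE h ?fsvalP.
  by have := h ([` kl]%fset); rewrite ffunE.
have lB (s : {ffun A -> spin S}) :
    is_local (fun x : cfg => \1_(cyl s) (translate k0 x) : R).
  apply: (@is_local_translate _ _ _ _ (\1_(cyl s))); exists A => u v uv.
  rewrite !cyl_indic (_ : restrict A u = restrict A v) //.
  by apply/ffunP => k; rewrite !ffunE uv // fsvalP.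
have /= -> := linear_on_local_sum (index_enum _) (fun s => f (glue s tau))
  (@apply_kernel_linear eta) lB.
apply: eq_bigr => s _; congr (_ * _).
pose A' := [fset (k - k0) | k in A]%fset.
pose t : cfg := fun j => glue s tau (j + k0).
rewrite (_ : (fun x => _) = \1_[set sigma : cfg | forall k, k \in A' -> sigma k = t k]).
  rewrite apply_kernel_indic; last exact: mB.
  rewrite pca_prod /= big_imfset /=; last by move=> x y _ _ /addIr.
  rewrite big_seq_fsetE /=; apply: eq_bigr => k _.
  by rewrite rate_translate /t subrK glue_in.
apply/funext => x; rewrite !indicE; congr (_%:R); congr nat_of_bool.
apply/idP/idP; rewrite !inE (cylE s tau) /= => h k.
  by move=> /imfsetP[j /= jA ->]; rewrite /t subrK -h.
move=> kA; have := h (k - k0); rewrite /t subrK; apply.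
by apply/imfsetP; exists k.
Qed.

Hypothesis Ploc : local_pca P.

Lemma norm1D (j k : site d) : (norm1 (j + k) <= norm1 j + norm1 k)%N.
Proof.
rewrite /norm1 -big_split /=; apply: leq_sum => i _; rewrite mxE.
by move: (j ord0 i) (k ord0 i) => x y; lia.
Qed.

Lemma apply_kernel_range : exists2 r, (0 < r)%N &
  forall j f, depends_on (ball1 d j) f -> depends_on (ball1 d (j + r)) (T f).
Proof.
have [V hV] := Ploc 0.
exists (\max_(k <- V) norm1 k).+1%N => // j f fj s e se.
rewrite !(apply_kernelE (@all_plus R d S) _ fj).
apply: eq_bigr => t _; congr (_ * _); apply: eq_bigr => k _.
rewrite Ptr [RHS]Ptr; apply: hV => i iV; rewrite /translate opprK; apply: se.
rewrite in_ball1; apply: leq_trans (norm1D _ _) _; rewrite addnC leq_add //.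
  by have := fsvalP k; rewrite in_ball1.
by apply: leqW; rewrite leq_bigmax_seq.
Qed.

Hypothesis Patt : attractive P.

Lemma apply_kernel_markov : local_markov T.
Proof.
have [r _ hr] := apply_kernel_range.
split=> [f fl|s|f g fl gl fg s|c s|f fl fi].
- by have [j /hr fj] := local_ball fl; exists (ball1 d (j + r)).
- exact: apply_kernel_linear.
- by apply: local_integral_le => //; exact: prob_kernel.
- by apply: local_integral_cst; exact: prob_kernel.
- by apply: Patt => //; exact: local_measurable.
Qed.

End pca_operator.

Section finite_volume.
Variables (R : realType) (d : nat) (S : spinSet R) (P : pca d S).
Local Notation cfg := (config d S).
Local Notation T := (apply_kernel P).
Local Notation plus := (@all_plus R d S).
Local Notation minus := (@all_minus R d S).
Implicit Types (f g : cfg -> R) (tau : cfg) (A B : {fset site d}).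

Definition fvop A tau f : cfg -> R := fun s => T f (cut A tau s).

Lemma fvop_depends A tau f : depends_on A (fvop A tau f).
Proof.
move=> s e se; rewrite /fvop; congr (T f _); apply/funext => k.
by rewrite /cut; case: ifP => // kA; rewrite se.
Qed.

Lemma iter_fvop_depends A tau f n : depends_on A f ->
  depends_on A (iter n (fvop A tau) f).
Proof. by case: n => [|n] //= _; exact: fvop_depends. Qed.

Lemma fvop_glue A tau f (e : {ffun A -> spin S}) : depends_on A f ->
  fvop A tau f (glue e tau) =
  \sum_(s : {ffun A -> spin S}) fv_kernel P tau e s * f (glue s tau).
Proof.
move=> fA; rewrite /fvop cut_glue (apply_kernelE P tau _ fA).
by apply: eq_bigr => s _; rewrite mulrC.
Qed.

Lemma stationary_iter A tau (m : {ffun A -> spin S} -> R) f n :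
  fv_stationary P tau m -> depends_on A f ->
  \sum_e m e * iter n (fvop A tau) f (glue e tau) = \sum_e m e * f (glue e tau).
Proof.
move=> [_ _ mst] fA; elim: n => [|n <-] //=.
under eq_bigr => e _ do rewrite (fvop_glue tau e (iter_fvop_depends tau n fA)) mulr_sumr.
rewrite exchange_big /=; apply: eq_bigr => s _.
rewrite -[in RHS]mst mulr_suml; apply: eq_bigr => e _.
by rewrite mulrA.
Qed.

Hypothesis Patt : attractive P.
Hypothesis Ploc : local_pca P.
Hypothesis Ptr : translation_invariant P.

Let hT : local_markov T.
Proof. exact: apply_kernel_markov. Qed.

Lemma fvop_markov A tau : local_markov (fvop A tau).
Proof.
split=> [f fl|s c f g fl gl|f g fl gl fg s|c s|f fl fi s e se]; rewrite /fvop.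
- by apply: (@is_local_cut _ _ _ _ _ (T f)); apply: (markov_local hT).
- by rewrite (markov_linear hT).
- exact: (markov_le hT).
- by rewrite (markov_cst hT).
- by apply: (markov_increasing hT) => //; apply: cut_le.
Qed.

Lemma fvop_plus_ge A : op_le T (fvop A plus).
Proof.
move=> f fl fi s; apply: (markov_increasing hT) => // k.
by rewrite /cut; case: ifP => // _; exact: splus_max.
Qed.

Lemma fvop_minus_le A : op_le (fvop A minus) T.
Proof.
move=> f fl fi s; apply: (markov_increasing hT) => // k.
by rewrite /cut; case: ifP => // _; exact: sminus_min.
Qed.

Lemma fvop_plus_anti A B : {subset A <= B} -> op_le (fvop B plus) (fvop A plus).
Proof.
move=> AB f fl fi s; apply: (markov_increasing hT) => // k.
rewrite /cut; case: (boolP (k \in A)) => [/AB ->//|_].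
by case: ifP => // _; exact: splus_max.
Qed.

Lemma fvop_minus_mono A B : {subset A <= B} -> op_le (fvop A minus) (fvop B minus).
Proof.
move=> AB f fl fi s; apply: (markov_increasing hT) => // k.
rewrite /cut; case: (boolP (k \in A)) => [/AB ->//|_].
by case: ifP => // _; exact: sminus_min.
Qed.

Lemma iter_fvop_translate_plus L k n f : k \in ball1 d L ->
  is_local f -> config_increasing f -> forall s,
  iter n (fvop (ball1 d (L + L)) plus) (fun s => f (translate (- k) s)) s <=
  iter n (fvop (ball1 d L) plus) f (translate (- k) s).
Proof.
move=> kL fl fi; have hU := fvop_markov (ball1 d (L + L)) plus.
have hV := fvop_markov (ball1 d L) plus.
elim: n => [//|n IH] s /=.
have hVn := markov_local (iter_markov n hV) fl.
apply: le_trans (markov_le hU _ _ IH s) _.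
- by apply: (markov_local (iter_markov n hU)); exact: is_local_translate.
- exact: is_local_translate.
rewrite /fvop apply_kernel_translate //.
apply: (markov_increasing hT) => // [|j].
  exact: (markov_increasing (iter_markov n hV)).
rewrite /translate /cut; case: (boolP (j \in ball1 d L)) => jL.
  rewrite in_ball1 opprK (leq_trans (norm1D _ _)) //.
  by move: jL kL; rewrite !in_ball1; exact: leq_add.
by case: ifP => // _; exact: splus_max.
Qed.

Lemma iter_fvop_translate_minus L k n f : k \in ball1 d L ->
  is_local f -> config_increasing f -> forall s,
  iter n (fvop (ball1 d L) minus) f (translate (- k) s) <=
  iter n (fvop (ball1 d (L + L)) minus) (fun s => f (translate (- k) s)) s.
Proof.
move=> kL fl fi; have hU := fvop_markov (ball1 d (L + L)) minus.
have hV := fvop_markov (ball1 d L) minus.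
elim: n => [//|n IH] s /=.
have hVn := markov_local (iter_markov n hV) fl.
apply: le_trans (markov_le hU _ _ IH s); last 2 first.
- exact: is_local_translate.
- by apply: (markov_local (iter_markov n hU)); exact: is_local_translate.
rewrite /fvop apply_kernel_translate //.
apply: (markov_increasing hT) => // [|j].
  exact: (markov_increasing (iter_markov n hV)).
rewrite /translate /cut; case: (boolP (j \in ball1 d L)) => jL.
  rewrite in_ball1 opprK (leq_trans (norm1D _ _)) //.
  by move: jL kL; rewrite !in_ball1; exact: leq_add.
by case: ifP => // _; exact: sminus_min.
Qed.

Definition rho L n : R :=
  iter n (fvop (ball1 d L) plus) (coord 0) plus -
  iter n (fvop (ball1 d L) minus) (coord 0) minus.

Let Xl k : is_local (@coord R d S k).
Proof. exact: is_local_coord. Qed.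

Let Xi k : config_increasing (@coord R d S k).
Proof. exact: coord_increasing. Qed.

Lemma coord_translate k : coord k = fun s : cfg => coord 0 (translate (- k) s).
Proof. by apply/funext => s; rewrite /coord /translate opprK add0r. Qed.

Lemma coord_diff_le_rho L k n : k \in ball1 d L ->
  iter n (fvop (ball1 d (L + L)) plus) (coord k) plus -
  iter n (fvop (ball1 d (L + L)) minus) (coord k) minus <= rho L n.
Proof.
move=> kL; rewrite coord_translate.
have := iter_fvop_translate_plus n kL (Xl 0) (Xi 0) plus.
have := iter_fvop_translate_minus n kL (Xl 0) (Xi 0) minus.
have -> : translate (- k) plus = plus by [].
have -> : translate (- k) minus = minus by [].
by rewrite /rho; lra.
Qed.

Lemma iter_fvop_minus_plus A B n : op_le (iter n (fvop A minus)) (iter n (fvop B plus)).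
Proof.
have hA := fvop_markov A minus; have hB := fvop_markov B plus.
move=> f fl fi s.
apply: le_trans (op_le_iter n hA hT (@fvop_minus_le A) fl fi s) _.
exact: (op_le_iter n hT hB (@fvop_plus_ge B)).
Qed.

Lemma rho_recursion (K : R) L s t N : 0 <= K ->
  (forall u v : spin S, u != v -> 1 <= K * `|spinval u - spinval v|) ->
  (t <= N)%N ->
  rho (L + L) (t + s) <=
  K * (#|` ball1 d L|)%:R * rho L s * rho L t + rho L (N + s).
Proof.
move=> K0 Kgap tN.
set Qp := fvop (ball1 d L) plus; set Qm := fvop (ball1 d L) minus.
set Up := fvop (ball1 d (L + L)) plus; set Um := fvop (ball1 d (L + L)) minus.
have hQp : local_markov Qp by exact: fvop_markov.
have hQm : local_markov Qm by exact: fvop_markov.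
have hUp : local_markov Up by exact: fvop_markov.
have hUm : local_markov Um by exact: fvop_markov.
have LL : {subset ball1 d L <= ball1 d (L + L)}.
  by move=> k; rewrite !in_ball1 => /leq_trans; apply; rewrite leq_addr.
pose gp := iter s Qp (coord 0); pose gm := iter s Qm (coord 0).
have gpl : is_local gp by exact: (markov_local (iter_markov s hQp)).
have gml : is_local gm by exact: (markov_local (iter_markov s hQm)).
have gpi : config_increasing gp by exact: (markov_increasing (iter_markov s hQp)).
have gmi : config_increasing gm by exact: (markov_increasing (iter_markov s hQm)).
have X0 : depends_on (ball1 d L) (@coord R d S 0).
  by move=> u v uv; rewrite /coord uv // origin_in_ball1.
have gpd : depends_on (ball1 d L) gp by exact: iter_fvop_depends.
have gmd : depends_on (ball1 d L) gm by exact: iter_fvop_depends.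
have oscle (g : cfg -> R) : config_increasing g -> forall k (u v : cfg),
    (forall j, j != k -> u j = v j) -> `|g u - g v| <= g plus - g minus.
  move=> gi k u v _; have := gi _ _ (all_plus_ge u); have := gi _ _ (all_plus_ge v).
  have := gi _ _ (all_minus_le u); have := gi _ _ (all_minus_le v).
  by rewrite ler_norml => *; apply/andP; split; lra.
have gmp u : gm u <= gp u by exact: iter_fvop_minus_plus.
have mp : config_le minus plus by exact: all_minus_le.
(* As [t <= N], [mu = delta_+ P^N] lies between the two finite-volume laws at
   time [t] and is dominated by those on the smaller box at time [N]. *)
pose mu f := iter N T f plus.
have mu1 : stoch_le mu (fun f => iter t Up f plus).
  move=> f fl fi; apply: le_trans (iter_plus_nonincreasing hT tN fl fi) _.
  exact: (op_le_iter t hT hUp (@fvop_plus_ge _)).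
have mu2 : stoch_le (fun f => iter t Um f minus) mu.
  move=> f fl fi; apply: le_trans (op_le_iter t hUm hT (@fvop_minus_le _) fl fi _) _.
  apply: le_trans (iter_minus_nondecreasing hT tN fl fi) _.
  exact: (markov_increasing (iter_markov N hT)).
have mul : linear_on_local mu by exact: (markov_linear (iter_markov N hT)).
have ul : linear_on_local (fun f => iter t Up f plus).
  exact: (markov_linear (iter_markov t hUp)).
have vl : linear_on_local (fun f => iter t Um f minus).
  exact: (markov_linear (iter_markov t hUm)).
have D0 (g : cfg -> R) : config_increasing g -> 0 <= g plus - g minus.
  by move=> gi; rewrite subr_ge0 gi.
have C1 := stoch_le_compare K0 Kgap mul ul mu1 gpd (fun=> D0 _ gpi) (oscle _ gpi).
have C2 := stoch_le_compare K0 Kgap vl mul mu2 gmd (fun=> D0 _ gmi) (oscle _ gmi).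
have E1 : iter (t + s) Up (coord 0) plus <= iter t Up gp plus.
  rewrite iterD; apply: (markov_le (iter_markov t hUp)) => //.
    exact: (markov_local (iter_markov s hUp)).
  by move=> u; apply: (op_le_iter s hUp hQp (fvop_plus_anti LL)).
have E2 : iter t Um gm minus <= iter (t + s) Um (coord 0) minus.
  rewrite iterD; apply: (markov_le (iter_markov t hUm)) => //.
    exact: (markov_local (iter_markov s hUm)).
  by move=> u; apply: (op_le_iter s hQm hUm (fvop_minus_mono LL)).
have E3 : mu gp <= iter (N + s) Qp (coord 0) plus.
  by rewrite iterD; apply: (op_le_iter N hT hQp (@fvop_plus_ge _)).
have E4 : iter (N + s) Qm (coord 0) minus <= mu gm.
  rewrite iterD; apply: le_trans (op_le_iter N hQm hT (@fvop_minus_le _) gml gmi _) _.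
  exact: (markov_increasing (iter_markov N hT)).
have dp : gp plus - gp minus <= rho L s.
  by rewrite /rho -/Qp -/Qm -/gp -/gm lerD2l lerN2.
have dm : gm plus - gm minus <= rho L s.
  by rewrite /rho -/Qp -/Qm -/gp -/gm lerD2r.
have sum_le (c : R) (b : site d -> R) : c <= rho L s -> (forall k, 0 <= b k) ->
    \sum_(k <- ball1 d L) c * b k <= rho L s * \sum_(k <- ball1 d L) b k.
  by move=> cs b0; rewrite mulr_sumr; apply: ler_sum => k _; apply: ler_wpM2r.
have C3 : rho L s * \sum_(k <- ball1 d L)
      (iter t Up (coord k) plus - mu (coord k)) +
    rho L s * \sum_(k <- ball1 d L)
      (mu (coord k) - iter t Um (coord k) minus) <=
    (#|` ball1 d L|)%:R * (rho L s * rho L t).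
  rewrite -mulrDr -big_split /= mulrCA ler_wpM2l ?(le_trans (D0 _ gpi)) //.
  have -> : (#|` ball1 d L|)%:R * rho L t = \sum_(k <- ball1 d L) rho L t.
    by rewrite big_const_seq count_predT iter_addr_0 mulr_natl.
  rewrite big_seq [leRHS]big_seq; apply: ler_sum => k kL.
  by have := coord_diff_le_rho t kL; rewrite -/Up -/Um; lra.
have F1 := sum_le _ (fun k => iter t Up (coord k) plus - mu (coord k)) dp _.
have F2 := sum_le _ (fun k => mu (coord k) - iter t Um (coord k) minus) dm _.
have {}F1 := F1 (fun k => ltac:(by rewrite subr_ge0; apply: mu1)).
have {}F2 := F2 (fun k => ltac:(by rewrite subr_ge0; apply: mu2)).
move: C1 C2 => /ler_normlP[_ C1] /ler_normlP[_ C2].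
have -> : rho (L + L) (t + s) =
  iter (t + s) Up (coord 0) plus - iter (t + s) Um (coord 0) minus by [].
have -> : rho L (N + s) =
  iter (N + s) Qp (coord 0) plus - iter (N + s) Qm (coord 0) minus by [].
have := ler_wpM2l K0 F1; have := ler_wpM2l K0 F2; have := ler_wpM2l K0 C3.
rewrite mulrDr.
have -> : K * (#|` ball1 d L|)%:R * rho L s * rho L t =
  K * ((#|` ball1 d L|)%:R * (rho L s * rho L t)) by rewrite !mulrA.
move: C1 C2 E1 E2 E3 E4; lra.
Qed.

End finite_volume.

Section exponential_decay.
Variable R : realType.

Lemma poly_le_exp (d : nat) (q : R) : 0 < q ->
  exists2 c : R, 0 < c & forall L : nat,
    (2 * L%:R + 1) ^+ d <= c * expR (q * L%:R).
Proof.
move=> q0; pose p := q / d.+1%:R.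
have p0 : 0 < p by rewrite divr_gt0.
have c0 : 0 < 2 / p + 1 by rewrite addr_gt0 // divr_gt0.
exists ((2 / p + 1) ^+ d) => [|L]; first by rewrite exprn_gt0.
have L0 : 0 <= L%:R :> R by [].
have pL : 0 <= p * L%:R by rewrite mulr_ge0 // ltW.
apply: (@le_trans _ _ ((2 / p + 1) ^+ d * (1 + p * L%:R) ^+ d)).
  have e1 : 2 * L%:R + 1 <= (2 / p + 1) * (1 + p * L%:R).
    have -> : (2 / p + 1) * (1 + p * L%:R) = 2 * L%:R + 1 + (2 / p + p * L%:R).
      by field; rewrite lt0r_neq0.
    by rewrite lerDl addr_ge0 // divr_ge0 // ltW.
  rewrite -exprMn; apply: lerXn2r; rewrite ?nnegrE //; lra.
rewrite ler_pM2l ?exprn_gt0 //.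
apply: (@le_trans _ _ (expR (p * L%:R) ^+ d)).
  by apply: lerXn2r; rewrite ?nnegrE ?expR_ge0 ?expR_ge1Dx //; lra.
rewrite -expRM_natl ler_expR mulrA ler_wpM2r // /p mulrCA.
by rewrite ler_piMr ?ltW // ltr_pdivrMr // mul1r ltr_nat.
Qed.

(* The induction hypothesis is [r L t <= exp (- m L) / D L] along
   [L = 2 ^ k L0], [t = 2 ^ k t0], where [D] absorbs the prefactor of [r ^ 2]. *)
Lemma doubling_decay (d : nat) (K C M : R) (L1 : nat) (r : nat -> nat -> R) :
  1 <= K -> 0 < C -> 0 < M ->
  (forall L t, 0 <= r L t) ->
  (forall L t, (L1 <= L)%N ->
     r (L + L)%N (t + t)%N <=
     K * (2 * L%:R + 1) ^+ d * r L t ^+ 2 + C * expR (- (M * L%:R))) ->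
  (forall L, (L1 <= L)%N -> exists2 t, (0 < t)%N &
     r L t <= (C + 1) * expR (- (M * L%:R))) ->
  exists (lam : R) (L0 t0 : nat), [/\ 0 < lam, (0 < t0)%N &
    forall k, K * r (L0 * 2 ^ k)%N (t0 * 2 ^ k)%N <=
      expR (- (lam * (t0 * 2 ^ k.+1)%:R))].
Proof.
move=> K1 C0 M0 r0 rec start.
pose m := M / 4; have m0 : 0 < m by rewrite divr_gt0.
have [c c0 hc] := poly_le_exp d m0.
have K0 : 0 < K by lra.
have p2 : 0 < 2 ^+ d.+1 :> R by rewrite exprn_gt0.
pose D (L : nat) : R := 2 ^+ d.+1 * K * (2 * L%:R + 1) ^+ d.
have pol1 (L : nat) : 1 <= (2 * L%:R + 1 : R) ^+ d.
  by rewrite exprn_ege1 // lerDr mulr_ge0.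
have DK (L : nat) : K <= D L.
  rewrite /D mulrAC -[leLHS]mul1r ler_pM2r // mulr_ege1 ?pol1 //.
  by rewrite exprn_ege1 // ler1n.
have D0 (L : nat) : 0 < D L by apply: lt_le_trans (DK L).
pose x (L : nat) := expR (- (m * L%:R)).
have x0 (L : nat) : 0 < x L by exact: expR_gt0.
have xm (L : nat) : expR (m * L%:R) * x L = 1 by rewrite /x -expRD subrr expR0.
have xge (L n : nat) : 0 <= x L ^+ n by rewrite exprn_ge0 // ltW.
have x4 (L : nat) : expR (- (M * L%:R)) = x L ^+ 4.
  by rewrite /x -expRM_natl /m; congr expR; field.
have x1 (L : nat) : x L <= 1.
  by rewrite /x -expR0 ler_expR oppr_le0 mulr_ge0 // ltW.
pose B := (C + 1) * 2 ^+ d.+1 * (2 ^+ d.+1 * K * c).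
have B0 : 0 < B by rewrite !mulr_gt0 //; lra.
pose L0 := maxn L1.+1 (Num.truncn (B / m)).+1.
have L0_gt0 : (0 < L0)%N by rewrite leq_max.
have small (L : nat) : (L0 <= L)%N -> (C + 1) * 2 ^+ d.+1 * D L * x L ^+ 2 <= 1.
  move=> L0L; have BL : B <= expR (m * L%:R).
    apply: le_trans (expR_ge1Dx _); apply: (@le_trans _ _ (m * L%:R)); last by lra.
    rewrite mulrC -ler_pdivrMr // ltW // (lt_le_trans (truncnS_gt _)) // ler_nat.
    by apply: leq_trans L0L; rewrite leq_max leqnn orbT.
  have e1 : D L <= 2 ^+ d.+1 * K * (c * expR (m * L%:R)).
    by rewrite ler_wpM2l ?hc // mulr_ge0 // ltW.
  apply: (@le_trans _ _ (B * expR (m * L%:R) * x L ^+ 2)).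
    apply: ler_wpM2r => //.
    apply: le_trans (ler_wpM2l _ e1) _; last by rewrite /B !mulrA.
    by apply: mulr_ge0; [lra|exact: ltW].
  rewrite expr2 mulrA -(mulrA B) xm mulr1 -(xm L).
  by apply: ler_wpM2r => //; exact: ltW.
have DD (L : nat) : D (L + L)%N <= 2 ^+ d * D L.
  rewrite /D [leRHS]mulrCA ler_pM2l ?mulr_gt0 // -exprMn.
  apply: lerXn2r; rewrite ?nnegrE.
  - by rewrite addr_ge0 // mulr_ge0.
  - by rewrite mulr_ge0 // addr_ge0 // mulr_ge0.
  by rewrite natrD; lra.
have L1L0 : (L1 <= L0)%N by rewrite leq_max leqnSn.
have [t0 t00 ht0] := start L0 L1L0.
have ind k : r (L0 * 2 ^ k)%N (t0 * 2 ^ k)%N <= x (L0 * 2 ^ k)%N / D (L0 * 2 ^ k)%N.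
  elim: k => [|k].
    rewrite !muln1; apply: le_trans ht0 _; rewrite x4 ler_pdivlMr //.
    have e1 : (C + 1) * D L0 * x L0 ^+ 2 <= 1.
      apply: le_trans (small _ (leqnn _)); apply: ler_wpM2r => //.
      rewrite mulrAC; apply: ler_peMr; last by rewrite exprn_ege1 // ler1n.
      by apply: mulr_ge0; [lra|exact: ltW].
    have -> : (C + 1) * x L0 ^+ 4 * D L0 =
      ((C + 1) * D L0 * x L0 ^+ 2) * (x L0 * x L0) by ring.
    apply: le_trans (ler_wpM2r _ e1) _; first by apply: mulr_ge0; exact: ltW.
    by rewrite mul1r; apply: ler_piMr => //; exact: ltW.
  rewrite expnS !mulnA ![(_ * 2)%N]mulnC -!mulnA !mul2n -!addnn.
  set L := (L0 * 2 ^ k)%N; set t := (t0 * 2 ^ k)%N => IH.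
  have L0L : (L0 <= L)%N by rewrite leq_pmulr // expn_gt0.
  apply: le_trans (rec L t (leq_trans L1L0 L0L)) _.
  have xx : x (L + L)%N = x L ^+ 2.
    by rewrite /x -expRM_natl natrD; congr expR; ring.
  rewrite x4 xx.
  have s1 := small _ L0L.
  have DL := D0 L; have xL := x0 L.
  apply: (@le_trans _ _ (x L ^+ 2 / (2 ^+ d * D L))); last first.
    rewrite ler_pM2l ?exprn_gt0 // lef_pV2 ?posrE ?mulr_gt0 ?exprn_gt0 //.
  have p2d : 0 < 2 ^+ d :> R by rewrite exprn_gt0.
  have -> : K * (2 * L%:R + 1) ^+ d = D L / 2 ^+ d.+1.
    by rewrite /D; field; rewrite lt0r_neq0.
  have rr : r L t ^+ 2 <= (x L / D L) ^+ 2.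
    by apply: lerXn2r; rewrite ?nnegrE // divr_ge0 // ltW.
  have h1 : D L / 2 ^+ d.+1 * r L t ^+ 2 <= x L ^+ 2 / (2 ^+ d.+1 * D L).
    apply: le_trans (ler_wpM2l _ rr) _; first by rewrite divr_ge0 // ltW.
    rewrite le_eqVlt; apply/orP; left; apply/eqP; field.
    by rewrite !lt0r_neq0.
  have h2 : C * x L ^+ 4 <= x L ^+ 2 / (2 ^+ d.+1 * D L).
    rewrite ler_pdivlMr ?mulr_gt0 //.
    have -> : C * x L ^+ 4 * (2 ^+ d.+1 * D L) =
      (C * 2 ^+ d.+1 * D L * x L ^+ 2) * x L ^+ 2 by ring.
    apply: ler_piMl => //; apply: le_trans s1.
    rewrite -!mulrA; apply: ler_wpM2r; last by rewrite lerDl.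
    by rewrite !mulr_ge0 // ltW.
  apply: le_trans (lerD h1 h2) _; rewrite le_eqVlt; apply/orP; left; apply/eqP.
  by rewrite [2 ^+ d.+1]exprS; field; rewrite !lt0r_neq0.
exists (m * L0%:R / (2 * t0%:R)), L0, t0; split => // [|k].
  by rewrite !(divr_gt0, mulr_gt0) // ltr0n.
apply: le_trans (ler_wpM2l (ltW K0) (ind k)) _.
rewrite mulrCA; apply: (@le_trans _ _ (x (L0 * 2 ^ k)%N)).
  by rewrite ler_piMr ?(ltW (x0 _)) // ler_pdivrMr // mul1r DK.
rewrite /x le_eqVlt; apply/orP; left; apply/eqP; congr expR; congr -%R.
rewrite expnS !natrM; field.
by rewrite pnatr_eq0 -lt0n.
Qed.

End exponential_decay.

Section finite_to_infinite_volume.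
Variables (R : realType) (d : nat) (S : spinSet R) (P : pca d S).
Local Notation cfg := (config d S).
Local Notation T := (apply_kernel P).
Local Notation plus := (@all_plus R d S).
Local Notation minus := (@all_minus R d S).
Implicit Types (f g : cfg -> R) (tau : cfg) (A B : {fset site d}).

Hypothesis Patt : attractive P.
Hypothesis Ploc : local_pca P.
Hypothesis Ptr : translation_invariant P.
Hypothesis Pnd : non_degenerate P.

Let hT : local_markov T.
Proof. exact: apply_kernel_markov. Qed.

Let hQ A tau : local_markov (fvop P A tau).
Proof. exact: fvop_markov. Qed.

Lemma config_le_plus_eq (s e : cfg) k : config_le s e -> s k = plus k ->
  e k = plus k.
Proof.
move=> se sk; apply/val_inj/le_anti/andP; split; first exact: splus_max.
by have := se k; rewrite sk.
Qed.

(* Doeblin condition: from any configuration the dynamics turns A into all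
   pluses with at least its probability c to do so from all minuses. *)
Lemma fvop_contraction A tau : exists c : R, [/\ 0 <= c, c < 1 &
  forall f, depends_on A f -> config_increasing f ->
    fvop P A tau f plus - fvop P A tau f minus <= c * (f plus - f minus)].
Proof.
pose E := cyl (restrict A plus) : set cfg.
have Ed : depends_on A (\1_E : cfg -> R).
  move=> u v uv; rewrite !cyl_indic (_ : restrict A u = restrict A v) //.
  by apply/ffunP => k; rewrite !ffunE uv // fsvalP.
have El : is_local (\1_E : cfg -> R) by exists A.
have Ei : config_increasing (\1_E : cfg -> R).
  move=> u v uv; rewrite !cyl_indic; case: eqP => [uE|_]; last by rewrite ler0n.
  rewrite (_ : restrict A v = restrict A plus) ?eqxx //; apply/ffunP => k.
  rewrite !ffunE; apply: (config_le_plus_eq uv).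
  by have := congr1 (fun g : {ffun A -> spin S} => g k) uE; rewrite !ffunE.
pose p := T \1_E minus.
have p0 : 0 < p.
  rewrite /p apply_kernel_indic ?pca_cyl; last exact: measurable_cyl.
  by apply: prodr_gt0 => k _.
have p1 : p <= 1.
  rewrite -[leRHS](markov_cst hT 1 minus).
  apply: (markov_le hT) El (is_local_cst d S 1) _ _ => s.
  by rewrite cyl_indic lern1 leq_b1.
exists (1 - p); split; rewrite ?subr_ge0 ?ltrBlDr ?ltrDl // => f fA fi.
have fl : is_local f by exists A.
have D0 : 0 <= f plus - f minus by rewrite subr_ge0; apply: fi; exact: all_plus_ge.
have lo : f minus + p * (f plus - f minus) <= fvop P A tau f minus.
  pose h : cfg -> R := fun s => (f plus - f minus) * \1_E s + f minus.
  have hl : is_local h.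
    by apply: is_localD; [exact: is_localZ|exact: is_local_cst].
  apply: (@le_trans _ _ (T h (cut A tau minus))).
    have /= -> := markov_linear hT (cut A tau minus) (f plus - f minus) El
      (is_local_cst d S (f minus)).
    rewrite (markov_cst hT) addrC lerD2r mulrC ler_wpM2l //.
    by apply: (markov_increasing hT) => //; exact: all_minus_le.
  apply: (markov_le hT) => // s; rewrite /h cyl_indic; case: eqP => [sE|_].
    rewrite mulr1 subrK le_eqVlt; apply/orP; left; apply/eqP/esym/fA => k kA.
    have := congr1 (fun g : {ffun A -> spin S} => g ([` kA]%fset)) sE.
    by rewrite !ffunE.
  by rewrite mulr0 add0r; apply: fi; exact: all_minus_le.
have hi : fvop P A tau f plus <= f plus.
  rewrite -[leRHS](markov_cst (hQ A tau) _ plus); 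
  apply: (markov_le (hQ A tau)) fl (is_local_cst d S _) _ _ => s.
  by apply: fi; exact: all_plus_ge.
by move: lo hi; lra.
Qed.

Lemma stationary_mean A tau (m : {ffun A -> spin S} -> R) f n :
  fv_stationary P tau m -> depends_on A f -> config_increasing f ->
  iter n (fvop P A tau) f minus <= \sum_e m e * f (glue e tau) /\
  \sum_e m e * f (glue e tau) <= iter n (fvop P A tau) f plus.
Proof.
move=> mst fA fi; rewrite -(stationary_iter n mst fA); case: (mst) => m0 m1 _.
have fl : is_local f by exists A.
have gi := markov_increasing (iter_markov n (hQ A tau)) fl fi.
split.
  rewrite -[leLHS]mul1r -m1 mulr_suml; apply: ler_sum => e _.
  by apply: ler_wpM2l => //; apply: gi; exact: all_minus_le.
rewrite -[leRHS]mul1r -m1 mulr_suml; apply: ler_sum => e _.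
by apply: ler_wpM2l => //; apply: gi; exact: all_plus_ge.
Qed.

Lemma fvop_limit A tau f (e : R) : depends_on A f -> config_increasing f ->
  0 < e -> exists N, forall n, (N <= n)%N ->
  iter n (fvop P A tau) f plus - iter n (fvop P A tau) f minus <= e.
Proof.
move=> fA fi e0; have [c [c0 c1 hc]] := fvop_contraction A tau.
have fl : is_local f by exists A.
have D0 : 0 <= f plus - f minus by rewrite subr_ge0; apply: fi; exact: all_plus_ge.
have geo n : iter n (fvop P A tau) f plus - iter n (fvop P A tau) f minus <=
    c ^+ n * (f plus - f minus).
  elim: n => [|n IH]; first by rewrite mul1r.
  have gi := markov_increasing (iter_markov n (hQ A tau)) fl fi.
  apply: le_trans (hc _ (iter_fvop_depends P tau n fA) gi) _.
  by rewrite exprS -mulrA ler_wpM2l.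
have cv : (fun n => c ^+ n * (f plus - f minus)) @ \oo --> (0 : R).
  rewrite -[X in _ --> X](mul0r (f plus - f minus)); apply: cvgM.
    by apply: cvg_expr; rewrite ger0_norm.
  exact: cvg_cst.
have /cvgrPdist_le /(_ e e0) [N _ hN] := cv.
exists N => n Nn; apply: le_trans (geo n) _.
by have := hN n Nn; rewrite sub0r normrN => /(le_trans (ler_norm _)).
Qed.

Lemma coord0_depends L : depends_on (ball1 d L) (@coord R d S 0).
Proof. by move=> u v uv; rewrite /coord uv // origin_in_ball1. Qed.

Lemma mean_originE L tau (m : {ffun ball1 d L -> spin S} -> R) :
  mean_origin m = \sum_e m e * @coord R d S 0 (glue e tau).
Proof. by apply: eq_bigr => s _; rewrite /coord -(glue_in s tau). Qed.

Lemma rho_limit L (mp mm : {ffun ball1 d L -> spin S} -> R) (e : R) :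
  fv_stationary P plus mp -> fv_stationary P minus mm -> 0 < e ->
  exists N, forall n, (N <= n)%N ->
    rho P L n <= mean_origin mp - mean_origin mm + e.
Proof.
move=> hp hm e0; have e2 : 0 < e / 2 by rewrite divr_gt0.
have X0 := @coord0_depends L; have Xi := @coord_increasing R d S 0.
have [N1 h1] := fvop_limit plus X0 Xi e2.
have [N2 h2] := fvop_limit minus X0 Xi e2.
exists (maxn N1 N2) => n; rewrite geq_max => /andP[/h1 {}h1 /h2 {}h2].
have [a1 _] := stationary_mean n hp X0 Xi.
have [_ a2] := stationary_mean n hm X0 Xi.
by rewrite (mean_originE plus mp) (mean_originE minus mm) /rho; lra.
Qed.

Lemma card_ball1 L : (#|` ball1 d L| <= (2 * L).+1 ^ d)%N.
Proof.
pose s := [seq (\row_i ((f i : nat)%:Z - L%:Z) : site d)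
             | f : {ffun 'I_d -> 'I_(2 * L).+1}].
have <- : size s = ((2 * L).+1 ^ d)%N by rewrite size_map -cardE card_ffun !card_ord.
apply: uniq_leq_size (fset_uniq _) _ => k.
by rewrite /ball1 !inE /= => /andP[].
Qed.

Definition rho_inf n : R :=
  iter n T (coord 0) plus - iter n T (coord 0) minus.

Lemma rho_inf_le L n : rho_inf n <= rho P L n.
Proof.
have Xl := @is_local_coord R d S 0; have Xi := @coord_increasing R d S 0.
apply: lerB; first exact: (op_le_iter n hT (hQ _ _) (fvop_plus_ge Patt Ploc Ptr (ball1 d L))).
exact: (op_le_iter n (hQ _ _) hT (fvop_minus_le Patt Ploc Ptr (ball1 d L))).
Qed.

Lemma rho_inf_ge0 n : 0 <= rho_inf n.
Proof.
rewrite subr_ge0; apply: (markov_increasing (iter_markov n hT)).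
- exact: is_local_coord.
- exact: coord_increasing.
exact: all_plus_ge.
Qed.

Lemma rho_inf_nonincreasing m n : (m <= n)%N -> rho_inf n <= rho_inf m.
Proof.
have Xl := @is_local_coord R d S 0; have Xi := @coord_increasing R d S 0.
by move=> mn; apply: lerB; [apply: iter_plus_nonincreasing|apply: iter_minus_nondecreasing].
Qed.

Lemma iter_apply_kernel_translate k0 n f s : is_local f ->
  iter n T (fun s => f (translate k0 s)) s = iter n T f (translate k0 s).
Proof.
move=> fl; elim: n s => [//|n IH] s /=.
rewrite -apply_kernel_translate //; last exact: (markov_local (iter_markov n hT)).
by congr (T _ s); apply/funext.
Qed.

Lemma iter_coord_plus k n : iter n T (coord k) plus = iter n T (coord 0) plus.
Proof. by rewrite coord_translate iter_apply_kernel_translate //; exact: is_local_coord. Qed.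

Lemma iter_coord_minus k n : iter n T (coord k) minus = iter n T (coord 0) minus.
Proof. by rewrite coord_translate iter_apply_kernel_translate //; exact: is_local_coord. Qed.

Lemma iter_compare (K : R) n mu A f (D : site d -> R) :
  0 <= K ->
  (forall u v : spin S, u != v -> 1 <= K * `|spinval u - spinval v|) ->
  linear_on_local mu ->
  stoch_le (fun f => iter n T f minus) mu ->
  stoch_le mu (fun f => iter n T f plus) ->
  depends_on A f -> (forall k, 0 <= D k) ->
  (forall k (s e : cfg), (forall j, j != k -> s j = e j) ->
     `|f s - f e| <= D k) ->
  `|mu f - iter n T f minus| <= (\sum_(k <- A) D k) * (K * rho_inf n).
Proof.
move=> K0 Kgap mul lo hi fA D0 fD.
have ml := markov_linear (iter_markov n hT) minus.
apply: le_trans (stoch_le_compare K0 Kgap ml mul lo fA D0 fD) _.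
rewrite mulrCA ler_wpM2l // mulr_suml; apply: ler_sum => k _.
apply: ler_wpM2l => //; rewrite iter_coord_minus lerD2r -(iter_coord_plus k).
by apply: hi; [exact: is_local_coord|exact: coord_increasing].
Qed.

Lemma rho_ge0 L n : 0 <= rho P L n.
Proof. exact: le_trans (rho_inf_ge0 n) (rho_inf_le L n). Qed.

Lemma exponential_ergodicity (nup num : forall L, {ffun ball1 d L -> spin S} -> R)
    (C M : R) (L1 : nat) :
  (forall L, (0 < L)%N -> fv_stationary P plus (nup L)) ->
  (forall L, (0 < L)%N -> fv_stationary P minus (num L)) ->
  0 < C -> 0 < M -> (0 < L1)%N ->
  (forall L, (L1 <= L)%N ->
     mean_origin (nup L) - mean_origin (num L) <= C * expR (- (M * L%:R))) ->
  exists (K lam : R) (n1 : nat), [/\ 0 <= K,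
    (forall u v : spin S, u != v -> 1 <= K * `|spinval u - spinval v|),
    0 < lam & forall n, (n1 <= n)%N -> K * rho_inf n <= expR (- (lam * n%:R))].
Proof.
move=> hp hm C0 M0 L10 hi; have [K K1 Kgap] := spin_gap S.
have K0 : 0 <= K by lra.
have [] := @doubling_decay R d K C M L1 (rho P) K1 C0 M0 rho_ge0.
- move=> L t L1L; have L0 := leq_trans L10 L1L.
  rewrite -[leRHS]addr0; apply/ler_addgt0Pl => e e0; rewrite addrC addr0.
  have [N hN] := rho_limit (hp _ L0) (hm _ L0) e0.
  apply: le_trans (rho_recursion Patt Ploc Ptr L t K0 Kgap (leq_maxl t N)) _.
  have c1 : K * (#|` ball1 d L|)%:R * rho P L t * rho P L t <=
      K * (2 * L%:R + 1) ^+ d * rho P L t ^+ 2.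
    rewrite -mulrA -expr2; apply: ler_wpM2r; first by rewrite exprn_ge0 ?rho_ge0.
    apply: ler_wpM2l => //; apply: (@le_trans _ _ ((2 * L).+1 ^ d)%:R).
      by rewrite ler_nat card_ball1.
    by rewrite natrX -addn1 natrD natrM.
  have := hN (maxn t N + t)%N (leq_trans (leq_maxr t N) (leq_addr _ _)).
  by have := hi _ L1L; move: c1; lra.
- move=> L L1L; have L0 := leq_trans L10 L1L.
  have [N hN] := rho_limit (hp _ L0) (hm _ L0) (expR_gt0 (- (M * L%:R))).
  exists N.+1 => //; apply: le_trans (hN _ (leqnSn N)) _.
  by rewrite mulrDl mul1r lerD2r hi.
move=> lam [L0 [t0 [lam0 t00 H]]]; exists K, lam, t0; split => // n t0n.
pose k := trunc_log 2 (n %/ t0).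
have nt : (0 < n %/ t0)%N by rewrite divn_gt0.
have /andP[k1 k2] := trunc_log_bounds (ltnSn 1) nt.
have tk1 : (t0 * 2 ^ k <= n)%N by rewrite mulnC -leq_divRL.
have tk2 : (n <= t0 * 2 ^ k.+1)%N.
  by rewrite ltnW // mulnC -ltn_divLR.
apply: (@le_trans _ _ (K * rho P (L0 * 2 ^ k) (t0 * 2 ^ k))).
  apply: ler_wpM2l => //; apply: le_trans (rho_inf_nonincreasing tk1) _.
  exact: rho_inf_le.
apply: le_trans (H k) _.
by rewrite ler_expR lerN2 ler_wpM2l ?(ltW lam0) // ler_nat.
Qed.

Lemma iter_fvop_range : exists2 r, (0 < r)%N & forall L n tau s, (r * n <= L)%N ->
  iter n (fvop P (ball1 d L) tau) (coord 0) s = iter n T (coord 0) s.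
Proof.
have [r r0 hr] := apply_kernel_range Ptr Ploc.
exists r => // L n tau.
have dep m : depends_on (ball1 d (r * m)) (iter m T (coord 0)).
  elim: m => [|m IH]; first exact: coord0_depends.
  by rewrite mulnS addnC; apply: hr.
elim: n => [//|n IH] s rn /=.
have {IH} -> : iter n (fvop P (ball1 d L) tau) (coord 0) = iter n T (coord 0).
  by apply/funext => u; apply: IH; rewrite (leq_trans _ rn) // leq_mul2l leqnSn orbT.
apply: (dep n.+1) => k kr; rewrite /cut ifT // in_ball1.
by move: kr; rewrite in_ball1 => /leq_trans; apply.
Qed.

End finite_to_infinite_volume.

(* The same configurations, carrying only the algebra of the sets that depend
   on finitely many sites, as input of Caratheodory's extension. *)
Definition local_config (R : realType) (d : nat) (S : spinSet R) : Type :=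
  config d S.

HB.instance Definition _ (R : realType) (d : nat) (S : spinSet R) :=
  Pointed.copy (local_config d S) (config d S).

Section local_sets.
Variables (R : realType) (d : nat) (S : spinSet R).
Local Notation cfg := (config d S).

Definition local_set (A : set cfg) : Prop := exists B : {fset site d},
  forall s e : cfg, (forall k, k \in B -> s k = e k) -> A s -> A e.

Lemma local_set0 : local_set set0.
Proof. by exists fset0. Qed.

Lemma local_setU (A B : set cfg) : local_set A -> local_set B ->
  local_set (A `|` B).
Proof.
move=> [X AX] [Y BY]; exists (X `|` Y)%fset => s e se [As|Bs].
  by left; apply: AX As => k kX; apply: se; rewrite in_fsetU kX.
by right; apply: BY Bs => k kY; apply: se; rewrite in_fsetU kY orbT.
Qed.

Lemma local_setC (A : set cfg) : local_set A -> local_set (~` A).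
Proof.
by move=> [X AX]; exists X => s e se nA Ae; apply: nA; apply: AX Ae => k /se.
Qed.

HB.instance Definition _ := isAlgebraOfSets.Build default_measure_display
  (local_config d S) local_set0 local_setU local_setC.

Lemma local_set_indic (A : set cfg) : local_set A -> is_local (\1_A : cfg -> R).
Proof.
move=> [X AX]; exists X => s e se; rewrite !indicE; congr (_%:R).
congr nat_of_bool; apply/idP/idP; rewrite !inE; apply: AX => // k /se //.
Qed.

Lemma measurable_sub_local (A : set cfg) :
  measurable A -> <<s (@measurable _ (local_config d S)) >> A.
Proof.
apply: smallest_sub; first exact: smallest_sigma_algebra.
move=> _ [k [s ->]]; apply: sub_sigma_algebra.
by exists [fset k]%fset => u v uv /= <-; rewrite uv // inE.
Qed.

Lemma local_set_measurable (A : set cfg) : local_set A -> measurable A.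
Proof.
move=> Al; apply/(measurable_indicP R A).
exact: (local_measurable (local_set_indic Al)).
Qed.

Lemma local_compact (B : nat -> set cfg) : (forall n, local_set (B n)) ->
  (forall m n, (m <= n)%N -> B n `<=` B m) -> (forall n, B n !=set0) ->
  exists s, forall n, B n s.
Proof.
move=> Bl Bd B0; pose x n := sval (cid (B0 n)).
have xB n : B n (x n) by rewrite /x; case: cid.
have [G [GU FG]] := ultraFilterLemma (@eventually_filter).
have GF : ProperFilter G by exact: ultra_proper.
have lim k : exists s : spin S, G [set n | x n k = s].
  apply: contrapT => no.
  have nG (s : spin S) : G (~` [set n | x n k = s]).
    by have [Gs|//] := in_ultra_setVsetC [set n | x n k = s] GU; case: no; exists s.
  have [n hn] := filter_ex (filter_forall GF nG).
  exact: (hn (x n k)).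
pose s : cfg := fun k => sval (cid (lim k)).
have sG k : G [set n | x n k = s k] by rewrite /s; case: cid.
exists s => n; have [X BX] := Bl n.
have [m [hm nm]] : exists m, (forall k, k \in X -> x m k = s k) /\ (n <= m)%N.
  have h1 : G (\bigcap_(k in [set` X]) [set m | x m k = s k]).
    by apply: filter_bigI => k _.
  have h2 : G [set m | (n <= m)%N] by apply: FG; exists n.
  have [m [a b]] := filter_ex (filterI h1 h2).
  by exists m; split => // k kX; apply: a.
exact: BX hm (Bd _ _ nm _ (xB m)).
Qed.

Lemma local_finite_union (F : nat -> set cfg) : (forall n, local_set (F n)) ->
  local_set (\bigcup_n F n) -> exists N, forall n, (N <= n)%N ->
  \bigcup_n F n = \big[setU/set0]_(i < n) F i.
Proof.
move=> Fl Ul; pose B n := \bigcup_n F n `\` \big[setU/set0]_(i < n) F i.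
have sl n : local_set (\big[setU/set0]_(i < n) F i).
  by apply: (big_ind local_set); [exact: local_set0|exact: local_setU|].
have Bl n : local_set (B n).
  have -> : B n = ~` (~` (\bigcup_n F n) `|` \big[setU/set0]_(i < n) F i).
    by rewrite setCU setCK.
  by apply: local_setC; apply: local_setU => //; exact: local_setC.
have Bd m n : (m <= n)%N -> B n `<=` B m.
  move=> mn; apply: setDS => s; rewrite -!bigcup_mkord => -[i /= im Fi].
  by exists i => //=; exact: leq_trans mn.
have [N BN] : exists N, ~ (B N !=set0).
  apply: contrapT => no; have [|s hs] := local_compact Bl Bd.
    by move=> n; apply: contrapT => h; apply: no; exists n.
  have [[i _ Fi] _] := hs 0%N; have [_] := hs i.+1; apply.
  by rewrite -bigcup_mkord; exists i => /=.
exists N => n Nn; apply/seteqP; split; last first.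
  by rewrite -bigcup_mkord => s [i _ Fi]; exists i.
move=> s Us; apply: contrapT => nU; apply: BN.
by exists s; apply: (Bd _ _ Nn); split.
Qed.

End local_sets.

Section extension.
Variables (R : realType) (d : nat) (S : spinSet R).
Local Notation cfg := (config d S).
Variable E : (cfg -> R) -> R.
Hypothesis El : linear_on_local E.
Hypothesis E0 : forall f, is_local f -> (forall s, 0 <= f s) -> 0 <= E f.
Hypothesis E1 : E (fun=> 1) = 1.

(* The absolute value only makes the content nonnegative on non-local sets. *)
Definition local_content (A : set (local_config d S)) : \bar R :=
  `|E (\1_(A : set cfg))|%:E.

Lemma local_contentE (A : set cfg) : local_set A ->
  local_content A = (E \1_A)%:E.
Proof.
move=> Al; rewrite /local_content ger0_norm //.
by apply: E0 => [|s]; [exact: local_set_indic|rewrite indicE ler0n].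
Qed.

Lemma indic_set0 : \1_(set0 : set cfg) = (fun=> 0) :> (cfg -> R).
Proof. by apply/funext => s; rewrite indicE in_set0. Qed.

Let content0 : local_content set0 = 0%E.
Proof. by rewrite /local_content indic_set0 linear_on_local0 // normr0. Qed.

Let content_ge0 A : (0 <= local_content A)%E.
Proof. by rewrite lee_fin. Qed.

Lemma local_content_sum (F : nat -> set cfg) n : (forall n, local_set (F n)) ->
  trivIset setT F ->
  \sum_(i < n) E \1_(F i) = E \1_(\big[setU/set0]_(i < n) F i).
Proof.
move=> Fl tF; elim: n => [|n IH].
  by rewrite !big_ord0 indic_set0 linear_on_local0.
rewrite !big_ord_recr /= IH.
have sl : local_set (\big[setU/set0]_(i < n) F i).
  by apply: (big_ind (@local_set R d S)); [exact: local_set0|exact: local_setU|].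
rewrite -(linear_on_localD El (local_set_indic sl) (local_set_indic (Fl n))).
congr (E _); apply/funext => s; rewrite !indicE in_setU.
have [sU|_] := boolP (s \in \big[setU/set0]_(i < n) F i); last by rewrite add0r.
suff -> : (s \in F n) = false by rewrite addr0.
apply/negP; rewrite inE => Fs; move: sU; rewrite inE -bigcup_mkord.
move=> [i /= iltn Fi]; move/trivIsetP : tF => 
  /(_ i n Logic.I Logic.I (negbT (ltn_eqF iltn))) Fin.
have : (F i `&` F n) s by [].
by rewrite Fin.
Qed.

Let content_sigma_additive : semi_sigma_additive local_content.
Proof.
move=> F mF tF mU; have [N hN] := local_finite_union mF mU.
apply: cvg_near_cst; exists N => // n /= Nn.
rewrite big_mkord (eq_bigr (fun i : 'I_n => (E \1_(F i))%:E)); last first.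
  by move=> i _; rewrite local_contentE //; exact: mF.
rewrite sumEFin local_content_sum // -hN // local_contentE //.
Qed.

HB.instance Definition _ := isMeasure.Build _ _ _ local_content
  content0 content_ge0 content_sigma_additive.

Definition local_extension (A : set cfg) : \bar R :=
  measure_extension local_content A.

Lemma local_extensionE (A : set cfg) : local_set A ->
  local_extension A = (E \1_A)%:E.
Proof.
move=> Al; rewrite /local_extension /measure_extension measurable_mu_extE //.
exact: local_contentE.
Qed.

Let ext0 : local_extension set0 = 0%E.
Proof. exact: (measure0 (measure_extension local_content)). Qed.

Let ext_ge0 A : (0 <= local_extension A)%E.
Proof. exact: (measure_ge0 (measure_extension local_content)). Qed.

Let ext_sigma_additive : semi_sigma_additive local_extension.
Proof.
move=> F mF tF mU.
apply: (@measure_semi_sigma_additive _ _ _ (measure_extension local_content)) => //.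
  by move=> i; apply: measurable_sub_local; exact: mF.
exact: measurable_sub_local.
Qed.

HB.instance Definition _ := isMeasure.Build _ _ _ local_extension
  ext0 ext_ge0 ext_sigma_additive.

Let ext1 : local_extension setT = 1%E.
Proof.
rewrite local_extensionE; last by exists fset0.
by rewrite (_ : \1_setT = fun=> 1) ?E1 //; apply/funext => s; rewrite indicE in_setT.
Qed.

HB.instance Definition _ := Measure_isProbability.Build _ _ _ local_extension ext1.

Lemma local_functional_representation : exists nu : probability cfg R,
  forall f, is_local f -> \int[nu]_s f s = E f.
Proof.
exists local_extension => f [A fA].
have cl (s : {ffun A -> spin S}) : local_set (cyl s).
  by exists A => u v uv us k; rewrite -us uv ?fsvalP.
rewrite (local_integral (@all_plus R d S) _ fA) ?ext1 //.
rewrite [in RHS](local_expand (@all_plus R d S) fA) linear_on_local_sum //.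
  apply: eq_bigr => s _; congr (_ * _).
  exact: (congr1 fine (local_extensionE (cl s))).
by move=> s; exact: local_set_indic.
Qed.


End extension.

Lemma eq_local_integral (R : realType) (d : nat) (S : spinSet R)
    (m1 m2 : probability (config d S) R) :
  (forall f, is_local f -> \int[m1]_s f s = \int[m2]_s f s) ->
  forall A, measurable A -> m1 A = m2 A.
Proof.
move=> m12 A mA.
apply: (@measure_unique _ R (config d S) (@local_set R d S) (fun=> setT)) => //.
- apply/seteqP; split; first exact: measurable_sub_local.
  apply: smallest_sub; first exact: sigma_algebra_measurable.
  exact: local_set_measurable.
- exact: (@measurableI _ (local_config d S)).
- by move=> _; exists fset0.
- by rewrite bigcup_const.
- move=> B Bl; have mB := local_set_measurable Bl.
  have /m12 := local_set_indic Bl.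
  rewrite /Rintegral !integral_indic ?setIT // => h.
  rewrite -[LHS]fineK ?fin_num_measure // -[RHS]fineK ?fin_num_measure //.
  by congr (_%:E).
- by move=> _; apply: le_lt_trans (probability_le1 m1 measurableT) _; rewrite ltry.
Qed.

Section oscillation.
Variables (R : realType) (d : nat) (S : spinSet R).
Local Notation cfg := (config d S).
Implicit Types (f : cfg -> R).

Lemma oscillation_real f : is_local f -> exists D : site d -> R,
  [/\ forall k, oscillation f k = (D k)%:E, forall k, 0 <= D k &
      forall k (s e : cfg), (forall j, j != k -> s j = e j) ->
        `|f s - f e| <= D k].
Proof.
move=> fl; have [M fM] := local_bounded fl.
have lo k (s e : cfg) : (forall j, j != k -> s j = e j) ->
    (`|f s - f e|%:E <= oscillation f k)%E.
  by move=> se; apply: ereal_sup_ubound; exists s, e.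
have lo0 k : (0 <= oscillation f k)%E.
  by have := lo k (@all_plus R d S) _ (fun _ _ => erefl); rewrite subrr normr0.
have hi k : (oscillation f k <= (2 * M)%:E)%E.
  apply: ge_ereal_sup => _ [s [e [_ ->]]]; rewrite lee_fin.
  apply: le_trans (ler_normB _ _) _.
  by have := fM s; have := fM e; lra.
have fin k : oscillation f k \is a fin_num.
  by rewrite ge0_fin_numE // (le_lt_trans (hi k)) ?ltry.
exists (fun k => fine (oscillation f k)); split=> [k|k|k s e se].
- by rewrite fineK.
- exact: fine_ge0.
- by rewrite -lee_fin fineK //; exact: lo.
Qed.

Lemma triple_norm_ge (A : {fset site d}) f (D : site d -> R) :
  (forall k, oscillation f k = (D k)%:E) ->
  ((\sum_(k <- A) D k)%:E <= triple_norm f)%E.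
Proof.
move=> fD; apply: esum_ge; exists [set` A].
  by split=> //; exact: finite_fset.
by rewrite fsbig_finite // set_fsetK -sumEFin; apply: lee_sum => k _; rewrite fD.
Qed.

Lemma triple_norm_coord0 : exists2 b : R, 0 <= b &
  triple_norm (@coord R d S 0) = b%:E.
Proof.
have [D [fD D0 _]] := oscillation_real (@is_local_coord R d S 0).
exists (D 0) => //.
rewrite -fD -(@esum_set1 R _ 0 (oscillation (@coord R d S 0))) ?fD ?lee_fin //.
rewrite esum_mkcond; apply: eq_esum => k _; case: ifPn => //.
rewrite notin_setE /= => /eqP k0; apply/le_anti/andP; split; last by rewrite fD lee_fin.
apply: ge_ereal_sup => _ [s [e [se ->]]].
by rewrite /coord (se 0) ?subrr ?normr0 // eq_sym.
Qed.

End oscillation.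

Lemma exp_decay_small (R : realType) (b lam e : R) : 0 <= b -> 0 < lam ->
  0 < e -> exists N, forall n, (N <= n)%N -> b * expR (- (lam * n%:R)) < e.
Proof.
move=> b0 lam0 e0; exists (Num.truncn (lam^-1 * (e^-1 * b))).+1 => n Nn.
rewrite expRN ltr_pdivrMr ?expR_gt0 // -ltr_pdivrMl //.
apply: lt_le_trans (expR_ge1Dx _); apply: (@lt_trans _ _ (lam * n%:R)); last by lra.
rewrite -ltr_pdivrMl //; apply: lt_le_trans (truncnS_gt _) _.
by rewrite ler_nat.
Qed.

Section evolution_of_measures.
Variables (R : realType) (d : nat) (S : spinSet R) (P : pca d S).
Local Notation cfg := (config d S).
Local Notation T := (apply_kernel P).
Local Notation plus := (@all_plus R d S).
Local Notation minus := (@all_minus R d S).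
Implicit Types (f : cfg -> R) (nu : probability cfg R).

Hypothesis Patt : attractive P.
Hypothesis Ploc : local_pca P.
Hypothesis Ptr : translation_invariant P.

Let hT : local_markov T.
Proof. exact: apply_kernel_markov. Qed.

Let prob1 nu : nu setT = 1%E.
Proof. exact: probability_setT. Qed.

Lemma kstep_integral nu f : is_local f ->
  \int[kstep P nu]_s f s = \int[nu]_s T f s.
Proof.
move=> [A fA]; have cl (s : {ffun A -> spin S}) : is_local (\1_(cyl s) : cfg -> R).
  by apply: local_set_indic; exists A => u v uv us k; rewrite -us uv ?fsvalP.
rewrite (local_integral plus (prob1 _) fA).
have -> : T f = fun e => \sum_(s : {ffun A -> spin S}) f (glue s plus) * T \1_(cyl s) e.
  apply/funext => e; rewrite {1}(local_expand plus fA).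
  exact: (linear_on_local_sum _ _ (@apply_kernel_linear R d S P e) cl).
have lin : linear_on_local (fun g : cfg -> R => \int[nu]_s g s).
  by move=> c g h gl hl; exact: (local_integral_linear c (prob1 nu) gl hl).
rewrite (linear_on_local_sum _ _ lin) => [|s]; last exact: (markov_local hT).
apply: eq_bigr => s _; congr (_ * fine _); apply: eq_integral => e _.
by rewrite /= apply_kernel_indic ?(cylE s plus) ?pca_prod // -cylE; exact: measurable_cyl.
Qed.

Lemma kiter_integral n nu f : is_local f ->
  \int[kiter P n nu]_s f s = \int[nu]_s iter n T f s.
Proof.
elim: n f => [//|n IH] f fl; rewrite iterSr -IH; last exact: (markov_local hT).
exact: kstep_integral.
Qed.

Lemma kiter_dirac n (s : cfg) f : is_local f ->
  \int[kiter P n (\d_s : probability _ _)]_x f x = iter n T f s.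
Proof.
move=> fl; rewrite kiter_integral // /Rintegral integral_dirac //.
  by rewrite diracT mul1e.
apply/measurable_EFinP; apply: local_measurable.
exact: (markov_local (iter_markov n hT)).
Qed.

Lemma stationary_integral n nu f : stationary P nu -> is_local f ->
  \int[nu]_s iter n T f s = \int[nu]_s f s.
Proof.
move=> st fl; elim: n => [//|n <-] /=.
have gl := markov_local (iter_markov n hT) fl.
rewrite -kstep_integral //; move: gl => [A gA].
rewrite !(local_integral plus (prob1 _) gA); apply: eq_bigr => s _.
congr (_ * fine _); exact: (st _ (measurable_cyl s)).
Qed.

Lemma stationary_stoch_le n nu : stationary P nu ->
  stoch_le (fun f => iter n T f minus) (fun f => \int[nu]_s f s) /\
  stoch_le (fun f => \int[nu]_s f s) (fun f => iter n T f plus).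
Proof.
move=> st; split=> f fl fi; rewrite -(stationary_integral n st fl);
  have gl := markov_local (iter_markov n hT) fl;
  have gi := markov_increasing (iter_markov n hT) fl fi.
- rewrite -[leLHS](local_integral_cst (m := nu) _ (prob1 nu)).
  apply: (local_integral_le (prob1 nu) (is_local_cst d S _) gl) => s.
  by apply: gi; exact: all_minus_le.
- rewrite -[leRHS](local_integral_cst (m := nu) _ (prob1 nu)).
  apply: (local_integral_le (prob1 nu) gl (is_local_cst d S _)) => s.
  by apply: gi; exact: all_plus_ge.
Qed.

Lemma integral_linear nu : linear_on_local (fun f => \int[nu]_s f s).
Proof. by move=> c f g fl gl; exact: (local_integral_linear c (prob1 nu) fl gl). Qed.

Lemma iter_stoch_le m n : (n <= m)%N ->
  stoch_le (fun f => iter n T f minus) (fun f => iter m T f minus) /\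
  stoch_le (fun f => iter m T f minus) (fun f => iter n T f plus).
Proof.
move=> nm; split=> f fl fi; first exact: iter_minus_nondecreasing.
apply: le_trans (iter_plus_nonincreasing hT nm fl fi).
by apply: (markov_increasing (iter_markov m hT) fl fi); exact: all_minus_le.
Qed.

Variables K lam : R.
Variable n1 : nat.
Hypothesis K0 : 0 <= K.
Hypothesis Kgap :
  forall u v : spin S, u != v -> 1 <= K * `|spinval u - spinval v|.
Hypothesis lam0 : 0 < lam.
Hypothesis decay : forall n, (n1 <= n)%N -> K * rho_inf P n <= expR (- (lam * n%:R)).

Lemma iter_minus_close n mu (A : {fset site d}) f (D : site d -> R) :
  (n1 <= n)%N -> linear_on_local mu ->
  stoch_le (fun f => iter n T f minus) mu ->
  stoch_le mu (fun f => iter n T f plus) ->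
  depends_on A f -> (forall k, 0 <= D k) ->
  (forall k (s e : cfg), (forall j, j != k -> s j = e j) ->
     `|f s - f e| <= D k) ->
  `|mu f - iter n T f minus| <= (\sum_(k <- A) D k) * expR (- (lam * n%:R)).
Proof.
move=> nn mul lo hi fA D0 fD.
apply: le_trans (iter_compare Patt Ploc Ptr K0 Kgap mul lo hi fA D0 fD) _.
by apply: ler_wpM2l; [exact: sumr_ge0|exact: decay].
Qed.

Definition local_limit f : R := lim ((fun n => iter n T f minus) @ \oo).

Lemma local_limit_cvg f : is_local f ->
  (fun n => iter n T f minus) @ \oo --> local_limit f.
Proof.
move=> fl; have [D [_ D0 fD]] := oscillation_real fl; have [A fA] := fl.
suff : cvg ((fun n => iter n T f minus) @ \oo) by [].
apply: cauchy_cvg; apply: cauchy_exP => e e0.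
have [N hN] := exp_decay_small (sumr_ge0 _ (fun k _ => D0 k) : 0 <= \sum_(k <- A) D k)
  lam0 e0.
exists (iter (maxn N n1) T f minus); exists (maxn N n1) => // m /= mN.
have [lo hi] := iter_stoch_le mN.
rewrite -ball_normE /ball_ /= distrC.
apply: le_lt_trans (hN _ (leq_maxl N n1)).
apply: (iter_minus_close (leq_maxr N n1) _ lo hi fA D0 fD).
exact: (markov_linear (iter_markov m hT)).
Qed.

Lemma local_limit_linear : linear_on_local local_limit.
Proof.
move=> c f g fl gl; apply/cvg_lim => //.
under eq_fun do rewrite (markov_linear (iter_markov _ hT)) //.
by apply: cvgD (local_limit_cvg gl); apply: cvgM (local_limit_cvg fl); exact: cvg_cst.
Qed.

Lemma local_limit_ge0 f : is_local f -> (forall s, 0 <= f s) -> 0 <= local_limit f.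
Proof.
move=> fl f0; apply: limr_ge; first exact: local_limit_cvg.
apply: nearW => n; rewrite -(markov_cst (iter_markov n hT) 0 minus).
exact: (markov_le (iter_markov n hT) (is_local_cst d S 0) fl f0).
Qed.

Lemma local_limit1 : local_limit (fun=> 1) = 1.
Proof.
apply/cvg_lim => //; under eq_fun do rewrite (markov_cst (iter_markov _ hT)).
exact: cvg_cst.
Qed.

Lemma local_limit_step f : is_local f -> local_limit (T f) = local_limit f.
Proof.
move=> fl; apply/cvg_lim => //; under eq_fun do rewrite -iterSr.
by have := local_limit_cvg fl; rewrite -(cvg_shiftS _).
Qed.

Lemma stationary_exists : exists nu, stationary P nu.
Proof.
have [nu hnu] := local_functional_representation local_limit_linear
  local_limit_ge0 local_limit1.
exists nu => A mA; apply: eq_local_integral mA => f fl.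
rewrite kstep_integral // !hnu ?local_limit_step //; exact: (markov_local hT).
Qed.

Lemma stationary_unique nu nu' : stationary P nu -> stationary P nu' ->
  forall A, measurable A -> nu' A = nu A.
Proof.
move=> st st'; apply: eq_local_integral => f fl.
have [D [_ D0 fD]] := oscillation_real fl; have [A fA] := fl.
apply/eqP; rewrite -subr_eq0 -normr_le0; apply/ler_addgt0Pl => e e0; rewrite addr0.
have e2 : 0 < e / 2 by rewrite divr_gt0.
have [N hN] := exp_decay_small (sumr_ge0 _ (fun k _ => D0 k) : 0 <= \sum_(k <- A) D k)
  lam0 e2.
have hb := hN _ (leq_maxl N n1); have nn := leq_maxr N n1.
have [l h] := stationary_stoch_le (maxn N n1) st.
have [l' h'] := stationary_stoch_le (maxn N n1) st'.
have := iter_minus_close nn (integral_linear nu) l h fA D0 fD.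
have := iter_minus_close nn (integral_linear nu') l' h' fA D0 fD.
rewrite !ler_norml => /andP[a1 a2] /andP[a3 a4]; apply/andP; split;
  by move: a1 a2 a3 a4 hb; lra.
Qed.

Lemma stationary_decay nu n f (s : cfg) : stationary P nu -> (n1 <= n)%N ->
  is_local f ->
  (`|\int[kiter P n (\d_s : probability _ _)]_x f x - \int[nu]_x f x|%:E
   <= 2%:E * triple_norm f * (expR (- (lam * n%:R)))%:E)%E.
Proof.
move=> st nn fl; rewrite kiter_dirac //.
have [D [fE D0 fD]] := oscillation_real fl; have [A fA] := fl.
have [l h] := stationary_stoch_le n st.
have h1 := iter_minus_close nn (integral_linear nu) l h fA D0 fD.
have ls : stoch_le (fun f => iter n T f minus) (fun f => iter n T f s).
  by move=> g gl gi; apply: (markov_increasing (iter_markov n hT) gl gi);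
     exact: all_minus_le.
have hs : stoch_le (fun f => iter n T f s) (fun f => iter n T f plus).
  by move=> g gl gi; apply: (markov_increasing (iter_markov n hT) gl gi);
     exact: all_plus_ge.
have h2 := iter_minus_close nn (markov_linear (iter_markov n hT) s) ls hs fA D0 fD.
apply: (@le_trans _ _ (2 * (\sum_(k <- A) D k) * expR (- (lam * n%:R)))%:E).
  rewrite lee_fin; move: h1 h2; rewrite !ler_norml.
  by move=> /andP[a1 a2] /andP[a3 a4]; apply/andP; split; lra.
rewrite 2!EFinM; apply: lee_wpmul2r; first by rewrite lee_fin expR_ge0.
by apply: lee_wpmul2l => //; exact: triple_norm_ge.
Qed.

End evolution_of_measures.

Section uniform_ergodicity_to_mixing.
Variables (R : realType) (d : nat) (S : spinSet R) (P : pca d S).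
Hypothesis Patt : attractive P.
Hypothesis Ploc : local_pca P.
Hypothesis Ptr : translation_invariant P.

Lemma mean_gap_le_rho_inf : exists2 r, (0 < r)%N &
  forall L n (mp mm : {ffun ball1 d L -> spin S} -> R),
  fv_stationary P (@all_plus R d S) mp -> fv_stationary P (@all_minus R d S) mm ->
  (r * n <= L)%N -> mean_origin mp - mean_origin mm <= rho_inf P n.
Proof.
have [r r0 hr] := iter_fvop_range Ploc Ptr.
exists r => // L n mp mm hp hm rn.
have X0 := @coord0_depends R d S L; have Xi := @coord_increasing R d S 0.
have [_ a1] := stationary_mean Patt Ploc Ptr n hp X0 Xi.
have [a2 _] := stationary_mean Patt Ploc Ptr n hm X0 Xi.
rewrite (mean_originE (@all_plus R d S) mp) (mean_originE (@all_minus R d S) mm).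
rewrite /rho_inf -(hr L n (@all_plus R d S) _ rn) -(hr L n (@all_minus R d S) _ rn).
exact: lerB a1 a2.
Qed.

Lemma mixing_of_ergodicity (nu : probability (config d S) R) (lam : R) (n1 : nat)
    (nup num : forall L, {ffun ball1 d L -> spin S} -> R) :
  (forall L, (0 < L)%N -> fv_stationary P (@all_plus R d S) (nup L)) ->
  (forall L, (0 < L)%N -> fv_stationary P (@all_minus R d S) (num L)) ->
  0 < lam ->
  (forall n, (n1 <= n)%N -> forall s : config d S,
    (`|\int[kiter P n (\d_s : probability _ _)]_x coord 0 x -
       \int[nu]_x coord 0 x|%:E
     <= 2%:E * triple_norm (@coord R d S 0) * (expR (- (lam * n%:R)))%:E)%E) ->
  exists (C M : R) (L1 : nat), [/\ 0 < C, 0 < M, (0 < L1)%N &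
    forall L : nat, (L1 <= L)%N ->
      mean_origin (nup L) - mean_origin (num L) <= C * expR (- (M * L%:R))].
Proof.
move=> hp hm lam0 erg; have [r r0 gap] := mean_gap_le_rho_inf.
have [b b0 bE] := triple_norm_coord0 d S.
have r0' : 0 < r%:R :> R by rewrite ltr0n.
have rho_le n : (n1 <= n)%N -> rho_inf P n <= 4 * b * expR (- (lam * n%:R)).
  move=> nn; have := erg n nn (@all_plus R d S); have := erg n nn (@all_minus R d S).
  rewrite !(kiter_dirac Patt Ploc Ptr) //; last 2 first.
  - exact: is_local_coord.
  - exact: is_local_coord.
  rewrite bE -!EFinM !lee_fin !ler_norml /rho_inf => /andP[a1 a2] /andP[a3 a4].
  by move: a1 a4; lra.
exists (4 * b * expR lam + 1), (lam / r%:R), (maxn 1 (r * n1)); split.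
- by rewrite ltr_wpDl // !mulr_ge0 // expR_ge0.
- by rewrite divr_gt0.
- by rewrite leq_max.
move=> L; rewrite geq_max => /andP[L0 rL].
pose n := (L %/ r)%N.
have rn : (r * n <= L)%N by rewrite mulnC leq_divM.
have nn : (n1 <= n)%N by rewrite leq_divRL // mulnC.
apply: le_trans (gap L n _ _ (hp _ L0) (hm _ L0) rn) _.
apply: le_trans (rho_le n nn) _.
have e1 : expR (- (lam * n%:R)) <= expR lam * expR (- (lam / r%:R * L%:R)).
  rewrite -expRD ler_expR.
  have Ln : L%:R <= r%:R * (n%:R + 1) :> R.
    by rewrite natr1 -natrM ler_nat mulnC ltnW // ltn_ceil.
  have : lam / r%:R * L%:R <= lam * (n%:R + 1).
    rewrite -mulrA ler_pM2l // mulrC ler_pdivrMr // mulrC //.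
  by lra.
apply: le_trans (ler_wpM2l _ e1) _; first by rewrite mulr_ge0.
by rewrite mulrA ler_wpM2r ?expR_ge0 // lerDl.
Qed.

End uniform_ergodicity_to_mixing.

Theorem theorem1 (R : realType) (d : nat) (S : spinSet R) (P : pca d S)
  (P_attractive : attractive P)
  (P_translation_invariant : translation_invariant P)
  (P_nondegenerate : non_degenerate P)
  (P_local : local_pca P)
  (nu_plus nu_minus : forall L : nat, {ffun ball1 d L -> spin S} -> R)
  (nu_plus_stationary : forall L : nat, (0 < L)%N ->
     fv_stationary P (all_plus S) (nu_plus L))
  (nu_minus_stationary : forall L : nat, (0 < L)%N ->
     fv_stationary P (all_minus S) (nu_minus L)) :
  (exists (C M : R) (L1 : nat),
     [/\ 0 < C, 0 < M, (0 < L1)%N &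
      forall L : nat, (L1 <= L)%N ->
        mean_origin (nu_plus L) - mean_origin (nu_minus L)
          <= C * expR (- (M * L%:R))])
  <->
  (exists nu : probability (config d S) R,
     [/\ stationary P nu,
         (forall nu' : probability (config d S) R, stationary P nu' ->
            forall A, measurable A -> nu' A = nu A) &
         exists (lambda : R) (n1 : nat), 0 < lambda /\
           forall n : nat, (n1 <= n)%N ->
           forall f : config d S -> R, is_local f ->
             (ereal_sup
                [set `|\int[kiter P n (\d_sigma : probability _ _)]_x f x
                       - \int[nu]_x f x|%:E
                | sigma in [set: config d S]]
              <= 2%:E * triple_norm f * (expR (- (lambda * n%:R)))%:E)%E]).
Proof.
have hp := nu_plus_stationary; have hm := nu_minus_stationary.
split=> [[C [M [L1 [C0 M0 L10 hi]]]]|[nu [_ _ [lam [n1 [lam0 erg]]]]]].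
  have [K [lam [n1 [K0 Kgap lam0 decay]]]] :=
    exponential_ergodicity P_attractive P_local P_translation_invariant
      P_nondegenerate hp hm C0 M0 L10 hi.
  have [nu st] := stationary_exists P_attractive P_local
    P_translation_invariant K0 Kgap lam0 decay.
  exists nu; split => // [nu' st'|].
    exact: (stationary_unique P_attractive P_local P_translation_invariant
      K0 Kgap lam0 decay st st').
  exists lam, n1; split => // n nn f fl.
  apply: ge_ereal_sup => _ [s _ <-].
  exact: (stationary_decay P_attractive P_local P_translation_invariant
    K0 Kgap decay s st nn fl).
apply: (mixing_of_ergodicity P_attractive P_local P_translation_invariant
  (nu := nu) (n1 := n1) hp hm lam0) => n nn s.
apply: le_trans; last exact: (erg n nn (coord 0) (is_local_coord S 0)).
by apply: ereal_sup_ubound; exists s.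
Qed.
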